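(* Let $\mathcal{C}$ be a class of piecewise expanding maps of $[0,1]$ such that: (1) $\mathcal{C}$ satisfies $(D_r)$ for some $r\ge 1$ and satisfies (Dec); (2) there exist $\lambda>1$ and $M\ge 1$ such that $\inf|T'|\ge\lambda$ and $\sup|T''|\le M$ for all $T\in\mathcal{C}$; (3) there exists $N\ge 1$ such that $\sharp\mathcal{A}_T\le N$ for all $T\in\mathcal{C}$. Let $(T_n)_{n\ge 1}$ be a sequence in $\mathcal{C}$ verifying (Min). Then there exist $t_0>0$ and $C>0$ such that for all $t>t_0$ and all $n\ge1$, $$m\left(\kappa(\mathcal{E}_n,m_n)>\frac{t}{\sqrt n}\right)\le e^{-Ct^2}.$$
   Context: $m$ is Lebesgue measure on $[0,1]$ with its Borel $\sigma$-algebra. A piecewise expanding map is a map $T:[0,1]\to[0,1]$ with $\inf_x|T'(x)|>1$ for which there is a finite partition $\mathcal{A}_T$ of $[0,1]$ into intervals with disjoint interiors such that $T$ can be extended to a $C^2$ map on a neighborhood of each element of $\mathcal{A}_T$. Its transfer operator $P_T:L^1(m)\to L^1(m)$ is characterized by $\int P_Tf\cdot g\,dm=\int f\cdot g\circ T\,dm$ for $f\in L^1(m)$, $g\in L^\infty(m)$. For $f\in L^1(m)$, $\mathrm{V}f$ is the infimum of the total variations on $[0,1]$ of the functions $\bar f$ with $\bar f=f$ $m$-a.e.; $\mathrm{BV}=\{f\in L^1(m):\mathrm{V}f<\infty\}$ with norm $\|f\|_{\mathrm{BV}}=\mathrm{V}f+\|f\|_{L^1_m}$. $(D_r)$: a class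 $\mathcal{C}$ of piecewise expanding maps satisfies $(D_r)$, $r\ge1$ an integer, if there are constants $0<\rho_r<1$, $M_0>0$, $C_r>0$ such that $\|P_Tf\|_{\mathrm{BV}}\le M_0\|f\|_{\mathrm{BV}}$ for all $T\in\mathcal{C}$, $f\in\mathrm{BV}$, and $\|P_{T_r}\cdots P_{T_1}f\|_{\mathrm{BV}}\le\rho_r\|f\|_{\mathrm{BV}}+C_r\|f\|_{L^1_m}$ for all $T_1,\ldots,T_r\in\mathcal{C}$, $f\in\mathrm{BV}$. (Dec): $\mathcal{C}$ satisfies (Dec) if there exist $0<\theta<1$ and $K_0>0$ such that for all $l\ge1$, all $T_1,\ldots,T_l\in\mathcal{C}$ and all $f\in\mathrm{BV}$ with $\int f\,dm=0$, $\|P_{T_l}\cdots P_{T_1}f\|_{\mathrm{BV}}\le K_0\theta^l\|f\|_{\mathrm{BV}}$. For a sequence $(T_n)_{n\ge1}$ and $n\le k$: $T_n^k=T_k\circ\cdots\circ T_n$, $P_n^k=P_{T_k}\cdots P_{T_n}$, and $T_1^0=\mathrm{Id}$. (Min): the sequence $(T_n)$ satisfies (Min) if there is $\delta>0$ with $P_1^n\mathbf{1}\ge\delta$ ($m$-a.e.) for all $n\ge1$. For $x\in[0,1]$ and $n\ge1$, the empirical measure is $\mathcal{E}_n(x)=\frac1n\sum_{k=0}^{n-1}\delta_{T_1^kx}$, and $m_n=\frac1n\sum_{k=0}^{n-1}(T_1^k)_\star m$ (average of the push-forwards of $m$). The Kantorovich distance between probability measures $\mu_1,\mu_2$ on $[0,1]$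 is $\kappa(\mu_1,\mu_2)=\int_0^1|F_{\mu_1}(t)-F_{\mu_2}(t)|\,dt$ with $F_{\mu_i}(t)=\mu_i([0,t])$; $\kappa(\mathcal{E}_n,m_n)$ denotes the function $x\mapsto\kappa(\mathcal{E}_n(x),m_n)$. *)

(* Defs.v *)
From HB Require Import structures.
From mathcomp Require Import all_boot all_order all_algebra.
From mathcomp Require Import all_classical all_reals all_analysis.
Import Order.TTheory GRing.Theory Num.Theory.
Import numFieldNormedType.Exports.

Set Implicit Arguments.
Unset Strict Implicit.
Unset Printing Implicit Defensive.

Local Open Scope classical_set_scope.
Local Open Scope ring_scope.

(* A function on [0,1] is a function [R -> R] whose values outside [0,1] are
   never used; an element of L^1(m) or L^oo(m) is handled through its
   representatives.  Measurability on [R] is Borel measurability. *)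

Section SequentialExpanding.
Context {R : realType}.
Implicit Types (T : R -> R) (A : set (set R)) (f g h : R -> R).

Local Notation mu := (@lebesgue_measure R).

Definition I01 : set R := `[0, 1].

Definition unit_lebesgue : set R -> \bar R :=
  mrestr mu (measurable_itv `[0%R, 1%R] : measurable I01).

Definition ae_eq01 f g : Prop := {ae mu, forall x, I01 x -> f x = g x}.

Definition C2_on (U : set R) g : Prop :=
  forall x, U x ->
    [/\ derivable g x 1, derivable (derive1 g) x 1 & {for x, continuous (derive1n 2 g)}].

(* The elements of the partition may share endpoints or be degenerate; only
   their interiors have to be disjoint. *)
Definition interval_partition A : Prop :=
  [/\ finite_set A,
      forall J, A J -> is_interval J,
      \bigcup_(J in A) J = I01 &
      trivIset A (@interior R)].

Definition regular_points A : set R := \bigcup_(J in A) interior J.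

(* The extension agrees with [T] in the interior of [J] only, so that [T] may
   jump at the endpoints; its domain is a neighborhood of the closure of [J],
   so that it is C^2 up to the endpoints even when [J] is not closed. *)
Definition piecewise_expanding T A : Prop :=
  [/\ set_fun I01 I01 T,
      interval_partition A,
      forall J, A J -> exists U g,
        [/\ open U, closure J `<=` U, C2_on U g &
            forall x, interior J x -> T x = g x] &
      (1 < ereal_inf [set (`|derive1 T x|)%:E | x in regular_points A])%E].

Definition Linfty01 g : Prop :=
  measurable_fun I01 g /\
  exists K : R, {ae mu, forall x, I01 x -> `|g x| <= K}.

Definition L1 f : Prop := mu.-integrable I01 (EFin \o f).

Definition is_transfer T f h : Prop :=
  L1 h /\
  forall g, Linfty01 g ->
    (\int[mu]_(x in I01) (h x * g x)%:E =
     \int[mu]_(x in I01) (f x * g (T x))%:E)%E.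

(* For [T] piecewise expanding and [f] in L^1(m), [is_transfer T f] holds for
   exactly one class modulo m-a.e. equality; this chooses a representative. *)
Definition transfer T f : R -> R := xget (cst 0) [set h | is_transfer T f h].

Definition essential_variation f : \bar R :=
  ereal_inf [set total_variation 0 1 g | g in [set g | ae_eq01 g f]].

Definition L1norm f : \bar R := (\int[mu]_(x in I01) `|f x|%:E)%E.

Definition BV f : Prop := L1 f /\ (essential_variation f < +oo)%E.

Definition BVnorm f : \bar R := (essential_variation f + L1norm f)%E.

(* [T 0] is not used: sequences of maps are indexed from 1. *)
Fixpoint seq_comp (T : nat -> R -> R) (k : nat) : R -> R :=
  if k is k'.+1 then T k \o seq_comp T k' else id.

Fixpoint seq_transfer (T : nat -> R -> R) (k : nat) (f : R -> R) : R -> R :=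
  if k is k'.+1 then transfer (T k) (seq_transfer T k' f) else f.

Definition cond_D (r : nat) (C : set (R -> R)) : Prop :=
  exists rho M0 Cr : R,
    [/\ 0 < rho < 1, 0 < M0, 0 < Cr,
        forall T f, C T -> BV f ->
          (BVnorm (transfer T f) <= M0%:E * BVnorm f)%E &
        forall (T : nat -> R -> R) f,
          (forall i, (1 <= i <= r)%N -> C (T i)) -> BV f ->
          (BVnorm (seq_transfer T r f)
             <= rho%:E * BVnorm f + Cr%:E * L1norm f)%E].

Definition cond_Dec (C : set (R -> R)) : Prop :=
  exists theta K0 : R,
    [/\ 0 < theta < 1, 0 < K0 &
        forall (l : nat) (T : nat -> R -> R) f,
          (1 <= l)%N -> (forall i, (1 <= i <= l)%N -> C (T i)) ->
          BV f -> (\int[mu]_(x in I01) (f x)%:E = 0)%E ->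
          (BVnorm (seq_transfer T l f) <= (K0 * theta ^+ l)%:E * BVnorm f)%E].

Definition cond_Min (T : nat -> R -> R) : Prop :=
  exists delta : R, 0 < delta /\
    forall n, (1 <= n)%N ->
      {ae mu, forall x, I01 x -> delta <= seq_transfer T n (cst 1) x}.

Definition empirical_measure (T : nat -> R -> R) (n : nat) (x : R)
    : set R -> \bar R :=
  fun B => ((n%:R^-1)%:E * \sum_(k < n) \d_(seq_comp T k x) B)%E.

Definition mean_measure (T : nat -> R -> R) (n : nat) : set R -> \bar R :=
  fun B =>
    ((n%:R^-1)%:E * \sum_(k < n) pushforward unit_lebesgue (seq_comp T k) B)%E.

Definition kantorovich (mu1 mu2 : set R -> \bar R) : \bar R :=
  (\int[mu]_(t in I01) `|mu1 `[0%R, t]%classic - mu2 `[0%R, t]%classic|)%E.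

End SequentialExpanding.

(* Main.v *)
(* For a fixed threshold t the sums over k < n of 1_[0,t](T_1^k x) minus its
   mean are subgaussian.  With h_k = P_1^k 1 >= delta and phi_k the centred
   indicator, (Dec) makes Q_n = sum_(k < n) P_(k+1)^n (phi_k h_k) bounded
   uniformly in n and t, so that H_n = Q_n / h_n is bounded and
   phi_k + H_k - H_(k+1) o T_(k+1) is a bounded reverse martingale difference
   with respect to h_k dm.  The inequality e^u <= u + e^(2 u^2) and an induction
   on the number of factors bound the exponential moment.  The deviation
   kappa(E_n, m_n) is the average over t of the absolute value of these sums
   divided by n, so convexity of the exponential and Tonelli's theorem transfer
   the exponential moment bound to kappa, and Markov's inequality concludes.

   The existence of the transfer operator on L^1 comes from the Radon-Nikodym
   theorem, the maps being nonsingular because of (Min): P_1^n 1 can be bounded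
   below only if it is not the default value of the choice operator. *)
Require Import Defs.
From HB Require Import structures.
From mathcomp Require Import all_boot all_order all_algebra.
From mathcomp Require Import all_classical all_reals all_analysis.
From mathcomp Require Import measurable_realfun ring lra.
Import Order.TTheory GRing.Theory Num.Theory.
Import numFieldNormedType.Exports.

Local Open Scope classical_set_scope.
Local Open Scope ring_scope.

Section Expanding.
Local Set Implicit Arguments.
Local Unset Strict Implicit.
Context {R : realType}.
Implicit Types (f g h u T : R -> R).
Local Notation mu := (@lebesgue_measure R).
Local Notation I := (@I01 R).
Local Notation J f := (Rintegral mu I f).
Local Notation TV := (total_variation 0 1).
Local Notation M := (measurableTypeR R).

(** * Almost everywhere statements, bounded functions and integrals on [0,1] *)

Lemma measurable_I01 : measurable I.
Proof. exact: measurable_itv. Qed.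
Local Notation mI := measurable_I01.

(* [lebesgue_measure] lives on [measurableTypeR R], which has the same measurable
   sets as [R] but another display. *)
Lemma measurable_I01s : @measurable _ (measurableTypeR R) I.
Proof. exact: measurable_I01. Qed.
Local Notation mIs := measurable_I01s.

Lemma lebesgue_I01 : mu I = 1%E.
Proof. by rewrite /I01 lebesgue_measure_itv /= lte_fin ltr01 -EFinD subr0. Qed.

Lemma lebesgue_I01_fin : (mu I < +oo)%E.
Proof. by rewrite lebesgue_I01 ltry. Qed.

Lemma ae01S (P Q : R -> Prop) : (forall x, I x -> P x -> Q x) ->
  {ae mu, forall x, I x -> P x} -> {ae mu, forall x, I x -> Q x}.
Proof.
move=> PQ; apply: (@filterS _ _ (ae_filter_ringOfSetsType mu)) => x h Ix.
by apply: PQ => //; exact: h.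
Qed.

Lemma ae01S2 (P Q S : R -> Prop) : (forall x, I x -> P x -> Q x -> S x) ->
  {ae mu, forall x, I x -> P x} -> {ae mu, forall x, I x -> Q x} ->
  {ae mu, forall x, I x -> S x}.
Proof.
move=> PQ; apply: (@filterS2 _ _ (ae_filter_ringOfSetsType mu)) => x h h' Ix.
by apply: PQ => //; [exact: h|exact: h'].
Qed.

Lemma ae01W (P : R -> Prop) : (forall x, I x -> P x) ->
  {ae mu, forall x, I x -> P x}.
Proof. by move=> h; apply: aeW. Qed.

(** The bound holds at every point and not just almost everywhere, so [bdd_comp] can compose with a
    map before that map is known to be nonsingular. *)
Definition bdd g :=
  measurable_fun I g /\ exists K : R, forall x, I x -> `|g x| <= K.

Lemma bdd_meas g : bdd g -> measurable_fun I g. Proof. by case. Qed.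

Lemma bddP g : bdd g -> exists2 K : R, 0 < K & forall x, I x -> `|g x| <= K.
Proof.
case=> _ [K hK]; exists (`|K| + 1); first by rewrite ltr_wpDl.
by move=> x /hK /le_trans -> //; rewrite (le_trans (ler_norm _))// lerDl.
Qed.

Lemma bdd_Linfty g : bdd g -> Linfty01 g.
Proof.
case=> mg [K hK]; split => //; exists K.
exact: aeW.
Qed.

Lemma bdd_cst (c : R) : bdd (cst c).
Proof. by split; [exact: measurable_cst|exists `|c|]. Qed.

Lemma bddD f g : bdd f -> bdd g -> bdd (fun x => f x + g x).
Proof.
move=> [mf [K hK]] [mg [K' hK']]; split; first exact: measurable_funD.
by exists (K + K') => x Ix; rewrite (le_trans (ler_normD _ _))// lerD// ?hK ?hK'.
Qed.

Lemma bddM f g : bdd f -> bdd g -> bdd (fun x => f x * g x).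
Proof.
move=> [mf [K hK]] [mg [K' hK']]; split; first exact: measurable_funM.
by exists (K * K') => x Ix; rewrite normrM ler_pM// ?hK ?hK'.
Qed.

Lemma bddZ (c : R) f : bdd f -> bdd (fun x => c * f x).
Proof. exact: bddM (bdd_cst c). Qed.

Lemma bddN f : bdd f -> bdd (fun x => - f x).
Proof.
by move=> /(bddZ (-1)); under [X in bdd X -> _]eq_fun do rewrite mulN1r.
Qed.

Lemma bddB f g : bdd f -> bdd g -> bdd (fun x => f x - g x).
Proof. by move=> bf bg; apply: bddD => //; exact: bddN. Qed.

Lemma bdd_expR f : bdd f -> bdd (fun x => expR (f x)).
Proof.
move=> [mf [K hK]]; split.
  exact: measurableT_comp (@measurable_expR R) mf.
by exists (expR K) => x Ix; rewrite ger0_norm ?expR_ge0// ler_expR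
  (le_trans (ler_norm _))// hK.
Qed.

Lemma bdd_comp g T : measurable_fun I T -> set_fun I I T -> bdd g ->
  bdd (fun x => g (T x)).
Proof.
move=> mT IT [mg [K hK]]; split; last by exists K => x /IT /hK.
by apply: (measurable_comp mI) => // _ [x Ix <-]; exact: IT.
Qed.

Lemma L1_meas f : L1 f -> measurable_fun I f.
Proof. by move=> /measurable_int /measurable_EFinP. Qed.

Lemma bdd_L1 g : bdd g -> L1 g.
Proof.
move=> bg; have [K K0 hK] := bddP bg; apply: measurable_bounded_integrable => //.
- exact: mI.
- exact: lebesgue_I01_fin.
- exact: bdd_meas.
- exists K; split; first exact: num_real.
  by move=> M KM x Ix; apply: le_trans (ltW KM); exact: hK.
Qed.

Lemma L1M f g : L1 f -> bdd g -> L1 (fun x => f x * g x).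
Proof.
move=> Lf bg; have [K K0 hK] := bddP bg.
apply: (@eq_integrable _ _ _ mu I mI ((EFin \o f) \* (EFin \o g))%E) => //.
apply: integrableMl => //; first exact: mI.
  exact: bdd_meas.
exists K; split; first exact: num_real.
by move=> M KM x Ix; apply: le_trans (ltW KM); exact: hK.
Qed.

Lemma L1D f g : L1 f -> L1 g -> L1 (fun x => f x + g x).
Proof. by move=> Lf Lg; apply: (integrableD mIs Lf Lg). Qed.

Lemma L1Z (c : R) f : L1 f -> L1 (fun x => c * f x).
Proof. by move=> Lf; apply: (integrableZl mIs c Lf). Qed.

Lemma L1B f g : L1 f -> L1 g -> L1 (fun x => f x - g x).
Proof. by move=> Lf Lg; apply: (integrableB mIs Lf Lg). Qed.

Lemma L1_norm f : L1 f -> L1 (fun x => `|f x|).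
Proof. exact: integrable_norm. Qed.

Lemma L1_EFin f : L1 f -> (\int[mu]_(x in I) (f x)%:E = (J f)%:E)%E.
Proof. by move=> Lf; rewrite /Rintegral fineK//; exact: (integrable_fin_num mIs Lf). Qed.

Lemma L1normE f : L1 f -> L1norm f = (J (fun x => `|f x|))%:E.
Proof. by move=> /L1_norm /L1_EFin. Qed.

(** The negative part of [g - f] vanishes almost everywhere, so only the positive part contributes
    to the integral. *)
Lemma ae_le_int f g : L1 f -> L1 g ->
  {ae mu, forall x, I x -> f x <= g x} -> J f <= J g.
Proof.
move=> Lf Lg fg.
rewrite -subr_ge0 -RintegralB//; try exact: mIs.
pose d := fun x => g x - f x.
have Ld : L1 d by exact: L1B.
rewrite -lee_fin -L1_EFin// integralE sube_ge0; last first.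
  by apply/orP; left; exact: (integrable_neg_fin_num mIs Ld).
apply: (@le_trans _ _ 0%E); last exact: integral_ge0.
have -> : (\int[mu]_(x in I) (EFin \o d)^\- x = \int[mu]_(x in I) (cst 0) x)%E.
  apply: ae_eq_integral => //; first exact: mI.
    by apply: measurable_funeneg; exact: measurable_int Ld.
  apply: ae01S fg => x Ix fgx.
  by rewrite funenegE /= max_r// lee_fin oppr_le0 subr_ge0.
by rewrite integral0.
Qed.

Lemma ae_eq_int f g : measurable_fun I f -> measurable_fun I g ->
  ae_eq01 f g -> J f = J g.
Proof.
move=> mf mg fg; congr fine; apply: ae_eq_integral => //; first exact: mI.
- exact/measurable_EFinP.
- exact/measurable_EFinP.
- by apply: ae01S fg => x Ix /= ->.
Qed.

Lemma le_int f g : L1 f -> L1 g -> (forall x, I x -> f x <= g x) -> J f <= J g.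
Proof. by move=> Lf Lg fg; apply: le_Rintegral => //; exact: mI. Qed.

Lemma eq_int f g : (forall x, I x -> f x = g x) -> J f = J g.
Proof. by move=> fg; apply: eq_Rintegral => x /[!inE]; exact: fg. Qed.

Lemma intD f g : L1 f -> L1 g -> J (fun x => f x + g x) = J f + J g.
Proof. by move=> Lf Lg; rewrite RintegralD//; exact: mI. Qed.

Lemma intB f g : L1 f -> L1 g -> J (fun x => f x - g x) = J f - J g.
Proof. by move=> Lf Lg; rewrite RintegralB//; exact: mI. Qed.

Lemma intZ (c : R) f : L1 f -> J (fun x => c * f x) = c * J f.
Proof. by move=> Lf; rewrite RintegralZl//; exact: mI. Qed.

Lemma int_cst (c : R) : J (cst c) = c.
Proof.
rewrite (Rintegral_cst _ mIs) -[RHS]mulr1; congr (c * _).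
exact: (congr1 fine lebesgue_I01).
Qed.

(** * Measurability of piecewise expanding maps *)

(** An interval exceeds its interior by at most two points. This matters because the pieces of an
    expanding map are controlled in the interiors only. *)
Lemma measurable_fun_interior T (i : interval R) :
  measurable_fun (interior [set` i]) T -> measurable_fun [set` i] T.
Proof.
have sub0 D : D = set0 -> measurable_fun D T.
  by move=> ->; exact: measurable_fun_set0.
case: i => [[b x|[]] [c y|[]]]; rewrite ?interior_itv => mT.
- have := @measurable_fun_itv_cc R x y false true T.
  move=> /(_ mT); apply: measurable_funS; first exact: measurable_itv.
  by apply: subset_itvScc; rewrite !bnd_simp//; case: b c => -[].
- by apply: sub0; rewrite set_itv_ge// -leNgt.
- by case: b => //; exact/measurable_fun_itv_obnd_cbndP.
- by case: c => //; exact/measurable_fun_itv_bndo_bndcP.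
- by apply: sub0; rewrite set_itv_ge// -leNgt.
- by [].
- by apply: sub0; rewrite set_itv_ge// -leNgt.
- by apply: sub0; rewrite set_itv_ge// -leNgt.
- by apply: sub0; rewrite set_itv_ge// -leNgt.
Qed.

(** In the interior of each piece the map agrees with a differentiable, hence continuous, extension;
    finitely many pieces cover [0,1]. *)
Lemma piecewise_expanding_measurable T (A : set (set R)) :
  piecewise_expanding T A -> measurable_fun I T.
Proof.
case=> _ [finA itvA UA _] TA _.
have mD D : A D -> measurable D by move=> /itvA; exact: is_interval_measurable.
have mT D : A D -> measurable_fun D T.
  move=> AD; have [U [g [oU DU C2g Tg]]] := TA _ AD.
  rewrite (iffLR (is_intervalP D) (itvA _ AD)).
  apply: measurable_fun_interior; rewrite -(iffLR (is_intervalP D) (itvA _ AD)).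
  apply: (@eq_measurable_fun _ _ _ _ _ g).
    by move=> x; rewrite inE => /Tg ->.
  apply: open_continuous_measurable_fun; first exact: open_interior.
  move=> x; rewrite inE => Dx.
  have /DU /C2g[/derivable1_diffP dg _ _] : closure D x.
    by apply: subset_closure; exact: interior_subset Dx.
  exact: differentiable_continuous.
move=> mI Y mY; rewrite -UA setI_bigcupl.
by apply: fin_bigcup_measurable => // D AD; apply: (mT D AD (mD D AD)).
Qed.

(** * Existence of the transfer operator *)

Lemma bdd_indic (A : set R) : measurable A -> bdd (\1_A : R -> R).
Proof.
move=> mA; split; first exact: measurable_indic.
by exists 1 => x _; rewrite indicE; case: (_ \in _); rewrite ?normr1 ?normr0.
Qed.

(** The sum counts the integers from 1 to [N] below [y]: it is the integer part of [y], and the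
    difference is the fractional part. *)
Lemma step_approx (N : nat) (y : R) : 0 <= y <= N%:R ->
  `|y - \sum_(i < N) (i.+1%:R <= y)%R%:R| <= 1.
Proof.
elim: N => [|N IH] /andP[y0 yN].
  by rewrite big_ord0 subr0 ger0_norm// (le_trans yN).
rewrite big_ord_recr /=.
have [yN'|yN'] := leP y N%:R.
  have /negbTE -> : ~~ (N.+1%:R <= y).
    by rewrite -ltNge (le_lt_trans yN')// ltr_nat.
  by rewrite addr0; apply: IH; rewrite y0.
rewrite (eq_bigr (fun=> 1)); last first.
  move=> i _; suff -> : i.+1%:R <= y by [].
  by rewrite (le_trans _ (ltW yN'))// ler_nat.
rewrite sumr_const card_ord -[1 *+ N]/(N%:R).
move: yN; rewrite -natr1 => yN.
case: (leP (N%:R + 1) y) => h /=; rewrite ler_norml; apply/andP; split; lra.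
Qed.

(** The defect [D] is linear, vanishes on indicators and is bounded by a constant on functions
    bounded by 1. An Archimedean argument then takes the place of a limit of simple functions. *)
Lemma dual_pairing_ext T f h : measurable_fun I T -> set_fun I I T ->
  L1 f -> L1 h ->
  (forall A, measurable A -> A `<=` I ->
     J (fun x => h x * \1_A x) = J (fun x => f x * \1_A (T x))) ->
  forall g, bdd g -> J (fun x => h x * g x) = J (fun x => f x * g (T x)).
Proof.
move=> mT IT Lf Lh fh g bg.
pose D u := J (fun x => h x * u x) - J (fun x => f x * u (T x)).
have L1f u : bdd u -> L1 (fun x => f x * u (T x)).
  by move=> bu; apply: L1M => //; exact: bdd_comp.
have DD u v : bdd u -> bdd v -> D (fun x => u x + v x) = D u + D v.
  move=> bu bv; rewrite /D.
  under eq_Rintegral do rewrite mulrDr.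
  under [X in _ - X]eq_Rintegral do rewrite mulrDr.
  rewrite !intD//; try exact: L1f; try exact: L1M.
  by rewrite opprD addrACA.
have DZ c u : bdd u -> D (fun x => c * u x) = c * D u.
  move=> bu; rewrite /D.
  under eq_Rintegral do rewrite mulrCA.
  under [X in _ - X]eq_Rintegral do rewrite mulrCA.
  by rewrite !intZ ?mulrBr//; [exact: L1f|exact: L1M].
have Dext u v : (forall x, I x -> u x = v x) -> D u = D v.
  move=> uv; rewrite /D; congr (_ - _); apply: eq_int => x Ix; first by rewrite uv.
  by rewrite uv//; exact: IT.
have DA A : measurable A -> A `<=` I -> D \1_A = 0.
  by move=> mA AI; rewrite /D fh// subrr.
have D1 : D (cst 1) = 0.
  rewrite -[RHS](DA I mI (fun x Ix => Ix)).
  by apply: Dext => x Ix; rewrite indicE mem_set.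

have Dsum (N : nat) (A : nat -> set R) : (forall i, measurable (A i)) ->
    (forall i, A i `<=` I) ->
    bdd (fun x => \sum_(i < N) \1_(A i) x) /\ D (fun x => \sum_(i < N) \1_(A i) x) = 0.
  move=> mA AI; elim: N => [|N [IH1 IH2]].
    under eq_fun do rewrite big_ord0; split; first exact: (bdd_cst 0).
    have := DA set0 measurable0 (@sub0set _ _); rewrite indic0; exact.
  under eq_fun do rewrite big_ord_recr /=; split.
    by apply: bddD => //; exact: bdd_indic.
  by rewrite DD// ?IH2 ?DA ?addr0//; exact: bdd_indic.
have Dle u : bdd u -> (forall x, I x -> `|u x| <= 1) ->
    `|D u| <= J (fun x => `|h x|) + J (fun x => `|f x|).
  move=> bu u1; rewrite /D (le_trans (ler_normB _ _))// lerD//.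
    apply: (le_trans (le_normr_Rintegral mIs (L1M Lh bu))).
    apply: le_int; [exact/L1_norm/L1M|exact: L1_norm|move=> x Ix].
    by rewrite normrM ler_piMr// u1.
  apply: (le_trans (le_normr_Rintegral mIs (L1f _ bu))).
  apply: le_int; [exact/L1_norm/L1f|exact: L1_norm|move=> x Ix].
  by rewrite normrM ler_piMr// u1//; exact: IT.
set c := _ + _ in Dle.
have [K K0 gK] := bddP bg.
(* A sum of indicators lies within 1 of [m (g + K)], so [m] times the defect of
   [g] is bounded independently of [m]. *)
have key (m : nat) : `|m%:R * D g| <= c.
  pose u x := m%:R * (g x + K).
  have bu : bdd u by apply: bddZ; apply: bddD => //; exact: bdd_cst.
  have [N uN] : exists N : nat, forall x, I x -> u x <= N%:R.
    exists (Num.truncn (m%:R * (K + K))).+1 => x Ix.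
    apply: le_trans (ltW (truncnS_gt _)).
    by rewrite ler_wpM2l// lerD2r (le_trans (ler_norm _))// gK.
  (* Level sets of [u], cut with [I] because [u] is measurable there only and [DA] asks for subsets
     of [I]. *)
  pose A i := I `&` [set x | i.+1%:R <= u x].
  have mA i : measurable (A i).
    have [mu_ _] := bu.
    exact: (@measurable_fun_ler _ _ _ I (cst i.+1%:R) u
      (@measurable_cst _ _ _ _ _ _) mu_ mI [set true] Logic.I).
  have [bS DS] := Dsum N A mA (fun i x Ax => proj1 Ax).
  have DuE : D u = m%:R * D g.
    rewrite DZ; last by apply: bddD => //; exact: bdd_cst.
    congr (_ * _); rewrite DD//; last exact: bdd_cst.
    have -> : D (fun=> K) = D (fun x => K * cst 1 x).
      by apply: Dext => x _; rewrite mulr1.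
    by rewrite DZ ?D1 ?mulr0 ?addr0//; exact: bdd_cst.
  rewrite -DuE.
  have -> : D u = D (fun x => u x - \sum_(i < N) \1_(A i) x).
    rewrite DD//; last exact: bddN.
    have -> : D (fun x => - \sum_(i < N) \1_(A i) x) =
        D (fun x => -1 * \sum_(i < N) \1_(A i) x).
      by apply: Dext => x _; rewrite mulN1r.
    by rewrite (DZ (-1) _ bS) DS mulr0 addr0.
  apply: Dle; first exact: bddB.
  move=> x Ix; under eq_bigr => i _.
    rewrite indicE (_ : (x \in A i) = (i.+1%:R <= u x)); last first.
      by apply/idP/idP; rewrite inE; [case|split].
    over.
  apply: step_approx; rewrite uN// andbT mulr_ge0// -(opprK K) subr_ge0.
  by have := gK _ Ix; rewrite ler_norml => /andP[].
(* If [D g] were nonzero, a multiple [m] larger than [c / |D g|] would contradict [key]. *)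
apply/eqP; rewrite -subr_eq0 -/(D g) -normr_eq0; apply/eqP/le_anti.
rewrite normr_ge0 andbT leNgt; apply/negP => Dg0.
have := key (Num.truncn (c / `|D g|)).+1.
rewrite normrM ger0_norm// leNgt -ltr_pdivrMr// => /negP; apply.
exact: truncnS_gt.
Qed.

Definition nonsingular T := forall N, measurable N -> mu N = 0%E ->
  mu (I `&` T @^-1` N) = 0%E.

Lemma integral_indic01 f (A : set R) : 
  (\int[mu]_(x in I `&` A) (f x)%:E = \int[mu]_(x in I) (f x * \1_A x)%:E)%E.
Proof.
by rewrite integral_mkcondr; apply: eq_integral => x _; rewrite epatch_indic.
Qed.

(** [h] is the Radon-Nikodym density of the image under [T] of the charge with density [f];
    nonsingularity is exactly the absolute continuity that this requires. *)
Lemma dual_density_exists T f : measurable_fun I T -> set_fun I I T ->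
  nonsingular T -> L1 f ->
  exists2 h, L1 h & forall A, measurable A -> A `<=` I ->
     J (fun x => h x * \1_A x) = J (fun x => f x * \1_A (T x)).
Proof.
move=> mT IT nsT Lf.
(* Off [I] the map takes a default value, which is harmless because [f] is cut off to [I] as
   well. *)
pose T0 : measurableTypeR R -> measurableTypeR R := T \_ I.
have mT0 : @measurable_fun _ _ (measurableTypeR R) (measurableTypeR R) setT T0.
  exact: (iffLR (measurable_restrictT T mI) mT).
have if0 : mu.-integrable [set: measurableTypeR R] ((EFin \o f) \_ I).
  exact: (iffLR (integrable_mkcond _ mIs) Lf).
pose nu0 : {charge set (measurableTypeR R) -> \bar R} := induced_charge if0.
pose nu : {charge set (measurableTypeR R) -> \bar R} :=
  measure_function_pushforward__canonical__charge_Charge nu0 mT0.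
have nuE A : nu A = (\int[mu]_(x in I `&` T @^-1` A) (f x)%:E)%E.
  rewrite /nu /= /pushforward /induced_charge.
  rewrite -(integral_mkcondr mu _ I) setIC; congr (integral _ _ _).
  by apply/seteqP; split => x [Ix]; rewrite /T0 /= /patch mem_set.
have numu : nu `<< mu.
  apply/null_content_dominatesP => A mA A0.
  rewrite nuE; apply: null_set_integral; last exact: nsT.
    exact: (mT mI A mA).
  apply: (@measurable_funS _ _ _ _ I) => //; first exact: measurable_I01.
  exact: measurable_int Lf.
pose rn := Radon_Nikodym nu mu.
have irn := Radon_Nikodym_integrable numu.
exists (fun x => fine (rn x)).
  rewrite /L1 (_ : _ \o _ = rn); first exact: (integrableS measurableT mIs _ irn).
  by apply/funext => x /=; rewrite fineK// Radon_Nikodym_fin_num.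
move=> A mA AI; congr fine; rewrite -!integral_indic01.
have -> : I `&` A = A by rewrite setIC; exact/setIidPl.
transitivity (nu A).
  rewrite (Radon_Nikodym_integral numu mA); apply: eq_integral => x _.
  by rewrite fineK// Radon_Nikodym_fin_num.
rewrite nuE integral_indic01.
by apply: eq_integral => x Ix; rewrite !indicE.
Qed.

(** The definition tests against essentially bounded functions. Such a [g] is replaced by a
    truncation, and nonsingularity ensures that [g \o T] changes on a null set only. *)
Lemma transfer_exists T f : measurable_fun I T -> set_fun I I T ->
  nonsingular T -> L1 f -> exists h, is_transfer T f h.
Proof.
move=> mT IT nsT Lf.
have [h Lh hA] := dual_density_exists mT IT nsT Lf.
have ext := dual_pairing_ext mT IT Lf Lh hA.
exists h; split => // g [mg [K gK]].
(* The absolute value keeps the two truncation levels in order whatever the sign of [K]. *)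
pose k x := Num.max (- `|K|) (Num.min (g x) `|K|).
have mk : measurable_fun I k.
  by apply: measurable_maxr => //; apply: measurable_minr.
have bk : bdd k.
  split => //; exists `|K| => x _; rewrite /k ler_norml le_max lexx /=.
  by rewrite ge_max ge_min lexx orbT andbT -subr_ge0 opprK addr_ge0.
have gk x : `|g x| <= K -> g x = k x.
  rewrite ler_norml => /andP[gK1 gK2]; have K0 := le_trans gK1 gK2.
  have KE : `|K| = K by rewrite ger0_norm//; lra.
  by rewrite /k KE min_l// max_r.
have [N [mN N0 gN]] := gK.
have mTmeas u : measurable_fun I u -> measurable_fun I (fun x => u (T x)).
  move=> mu_; apply: (measurable_comp mI) => // _ [x Ix <-]; exact: IT.
transitivity (\int[mu]_(x in I) (h x * k x)%:E)%E.
  apply: ae_eq_integral => //.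
  - exact: mIs.
  - by apply/measurable_EFinP; apply: measurable_funM => //; exact: L1_meas.
  - by apply/measurable_EFinP; apply: measurable_funM => //; exact: L1_meas.
  - by apply: ae01S gK => x Ix /gk ->.
transitivity (\int[mu]_(x in I) (f x * k (T x))%:E)%E.
  by rewrite !L1_EFin ?ext//; apply: L1M => //; exact: bdd_comp.
apply: ae_eq_integral => //.
- exact: mIs.
- apply/measurable_EFinP; apply: measurable_funM; first exact: L1_meas.
  exact: mTmeas.
- apply/measurable_EFinP; apply: measurable_funM; first exact: L1_meas.
  exact: mTmeas.
(* Truncation affects [g] only inside the null set [N], hence [g \o T] only inside its preimage. *)
- exists (I `&` T @^-1` N); split; [exact: (mT mI N mN)|exact: nsT|].
  move=> x /= h0; have Ix : I x by apply: contrapT => nIx; apply: h0 => /nIx.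
  split => //; apply: gN => /= h1; apply: h0 => _.
  by rewrite -gk//; apply: h1; exact: IT.
Qed.

(** * Bounded variation *)

Lemma I01E (x : R) : I x -> 0 <= x <= 1.
Proof. by rewrite /I01 /= in_itv. Qed.

Lemma total_variation_dist g (v : R) : (TV g <= v%:E)%E ->
  forall x y, I x -> I y -> `|g x - g y| <= v.
Proof.
move=> gv.
have le x y : I x -> I y -> x <= y -> `|g y - g x| <= v.
  move=> /I01E/andP[x0 x1] /I01E/andP[y0 y1] xy; rewrite -lee_fin.
  apply: le_trans gv; apply: (le_trans (total_variation_ge g xy)).
  rewrite (total_variationD _ x0 x1) (total_variationD _ xy y1).
  rewrite -[leLHS]add0e leeD// ?total_variation_ge0//.
  by rewrite -[leLHS]adde0 leeD// total_variation_ge0.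
move=> x y Ix Iy; have [xy|/ltW yx] := leP x y; last exact: le.
by rewrite distrC; exact: le.
Qed.

(** The inequality [|g x| <= v + |g y|] is averaged over [y], where [g] may be replaced by [f]. *)
Lemma total_variation_bound f g (v : R) : L1 f -> ae_eq01 g f ->
  (TV g <= v%:E)%E -> forall x, I x -> `|g x| <= v + J (fun y => `|f y|).
Proof.
move=> Lf gf gv x Ix; rewrite -lerBlDl -[leLHS]int_cst.
apply: ae_le_int; [exact/bdd_L1/bdd_cst|exact: L1_norm|].
apply: ae01S gf => y Iy <- /=; rewrite lerBlDl.
rewrite -[X in `|X|](subrK (g y)) (le_trans (ler_normD _ _))// lerD2r.
exact: total_variation_dist.
Qed.

Lemma essential_variation_ge0 f : (0 <= essential_variation f)%E.
Proof.
by apply: le_ereal_inf_tmp => _ [g _ <-]; apply: total_variation_ge0; exact: ler01.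
Qed.

Lemma BVnorm_ge0 f : (0 <= BVnorm f)%E.
Proof. by rewrite adde_ge0 ?essential_variation_ge0// integral_ge0. Qed.

Lemma BVnorm_le f g (v : R) : L1 f -> ae_eq01 g f -> (TV g <= v%:E)%E ->
  BV f /\ (BVnorm f <= (v + J (fun y => `|f y|))%:E)%E.
Proof.
move=> Lf gf gv.
have ev : (essential_variation f <= v%:E)%E.
  by apply: le_trans gv; apply: ereal_inf_lbound; exists g.
split; first by split => //; exact: le_lt_trans ev (ltry _).
by rewrite /BVnorm L1normE// EFinD leeD2r.
Qed.

(** The essential variation is an infimum; the strict inequality yields a representative without
    asking that it be attained. Norm bounds are kept strict below for this reason. *)
Lemma BVnorm_lt_repr f (b : R) : L1 f -> (BVnorm f < b%:E)%E ->
  exists g, ae_eq01 g f /\ (TV g <= (b - J (fun y => `|f y|))%:E)%E.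
Proof.
move=> Lf; rewrite /BVnorm L1normE// -lteBrDr// => /ereal_inf_lt[_ [g gf <-] gb].
by exists g; split => //; rewrite ltW// EFinB.
Qed.

Lemma BV_BVnorm f (b : R) : L1 f -> (BVnorm f <= b%:E)%E -> BV f.
Proof.
move=> Lf fb; split=> //; apply: (@le_lt_trans _ _ (BVnorm f)).
  by rewrite /BVnorm leeDl// integral_ge0.
exact: le_lt_trans fb (ltry _).
Qed.

Lemma BVnorm_ae_bound f (b : R) : L1 f -> (BVnorm f < b%:E)%E ->
  {ae mu, forall x, I x -> `|f x| <= b}.
Proof.
move=> Lf /(BVnorm_lt_repr Lf)[g [gf gv]].
apply: (ae01S _ gf) => x Ix <-.
by have := total_variation_bound Lf gf gv Ix; rewrite subrK.
Qed.

(** Discrete Leibniz rule, applied to each increment of a subdivision. *)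
Lemma total_variationM u g (a b p q : R) :
  (forall x, I x -> `|u x| <= a) -> (forall x, I x -> `|g x| <= b) ->
  (TV u <= p%:E)%E -> (TV g <= q%:E)%E ->
  (TV (fun x => u x * g x)%R <= (a * q + b * p)%:E)%E.
Proof.
move=> ua gb up gq; apply: ge_ereal_sup => _ [_ [s ps <-] <-]; rewrite lee_fin.
have a0 : 0 <= a by apply: le_trans (ua 0 _); rewrite // /I01 /= in_itv /= lexx ler01.
have b0 : 0 <= b by apply: le_trans (gb 0 _); rewrite // /I01 /= in_itv /= lexx ler01.
have {}gq : variation 0 1 g s <= q.
  rewrite -lee_fin; apply: le_trans gq; apply: ereal_sup_ubound.
  by exists (variation 0 1 g s) => //; exact: variations_variation.
have {}up : variation 0 1 u s <= p.
  rewrite -lee_fin; apply: le_trans up; apply: ereal_sup_ubound.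
  by exists (variation 0 1 u s) => //; exact: variations_variation.
apply: (@le_trans _ _ (a * variation 0 1 g s + b * variation 0 1 u s)); last first.
  by rewrite lerD// ler_wpM2l.
rewrite /variation !mulr_sumr -big_split /=; rewrite !big_mkord; apply: ler_sum => i _.
have In m : (m < (size s).+1)%N -> I (nth 1 (0 :: s) m).
  by move=> ms; rewrite /I01 /= in_itv /= itv_partition_nth_ge// itv_partition_nth_le.
have i1 := In _ (ltn_ord i : (i.+1 < (size s).+1)%N).
have i0 := In _ (ltnW (ltn_ord i : (i.+1 < (size s).+1)%N)).
set x := nth _ (_ :: _) _ in i0 *; set y := nth _ _ _ in i1 *.
have -> : u y * g y - u x * g x = u y * (g y - g x) + g x * (u y - u x) by ring.
rewrite (le_trans (ler_normD _ _))// !normrM lerD// ler_wpM2r//; [exact: ua|exact: gb].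
Qed.

(** On [0,1] the condition [z <= t] is membership in [[0, t]]. The constant [c] will be the mean of
    the indicator at the time considered. *)
Definition centered_indic (t c : R) : R -> R := fun z => (z <= t)%R%:R - c.

Lemma centered_indic_bound (t c : R) : 0 <= c <= 1 ->
  forall z, `|centered_indic t c z| <= 1.
Proof.
move=> /andP[c0 c1] z; rewrite /centered_indic ler_norml.
by case: (z <= t) => /=; apply/andP; split; lra.
Qed.

Lemma bdd_le (t : R) : bdd (fun z => (z <= t)%R%:R).
Proof.
rewrite (_ : (fun z => _) = \1_`]-oo, t]); first exact: bdd_indic.
apply/funext => z; rewrite indicE; congr (nat_of_bool _)%:R; apply/esym.
by apply/idP/idP => [|zt]; rewrite inE /= in_itv.
Qed.

Lemma bdd_centered_indic (t c : R) : bdd (centered_indic t c).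
Proof. exact: bddB (bdd_le t) (bdd_cst c). Qed.

Lemma total_variation_centered_indic (t c : R) : (TV (centered_indic t c) <= 1%:E)%E.
Proof.
have nd : {in `[0, 1] &, nondecreasing_fun (\- centered_indic t c)}.
  move=> x y _ _ xy; rewrite lerN2 lerD2r ler_nat.
  by have [yt|//] := boolP (y <= t); rewrite (le_trans xy yt).
rewrite -total_variationN (nondecreasing_total_variation _ nd)//.
rewrite lee_fin /=.
have : 0 <= centered_indic t c 0 + c <= 1.
  by rewrite /centered_indic subrK ler0n lern1 leq_b1.
have : 0 <= centered_indic t c 1 + c <= 1.
  by rewrite /centered_indic subrK ler0n lern1 leq_b1.
by move=> /andP[? ?] /andP[? ?]; lra.
Qed.

(** The centred indicator has supremum and variation at most 1 for every threshold, so the Leibniz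
    rule gives a bound uniform in [t]. The computation yields [2 * b]; the factor 3 is a comfortable
    majorant. *)
Lemma BVnorm_centered_indic_mul f (b t c : R) : 0 <= c <= 1 ->
  L1 f -> (BVnorm f < b%:E)%E ->
  [/\ L1 (fun x => centered_indic t c x * f x), BV (fun x => centered_indic t c x * f x) &
   (BVnorm (fun x => centered_indic t c x * f x)%R <= (3 * b)%:E)%E].
Proof.
move=> c01 Lf fb.
have [g [gf gv]] := BVnorm_lt_repr Lf fb.
have gb x : I x -> `|g x| <= b.
  by move=> Ix; have := total_variation_bound Lf gf gv Ix; rewrite subrK.
have Luf : L1 (fun x => centered_indic t c x * f x).
  by under eq_fun do rewrite mulrC; apply: L1M => //; exact: bdd_centered_indic.
have guf : ae_eq01 (fun x => centered_indic t c x * g x)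
    (fun x => centered_indic t c x * f x).
  by apply: (ae01S _ gf) => x _ ->.
have [BVuf nuf] := BVnorm_le Luf guf
  (total_variationM (fun x _ => centered_indic_bound t c01 x) gb
    (total_variation_centered_indic t c) gv).
split => //; apply: (le_trans nuf); rewrite lee_fin.
have J0 : 0 <= J (fun y => `|f y|) by exact: Rintegral_ge0.
have b0 : 0 <= b.
  by rewrite -lee_fin (le_trans (BVnorm_ge0 f))// ltW.
have Jb : J (fun y => `|f y|) <= b.
  rewrite -lee_fin -L1normE// ltW// (le_lt_trans _ fb)// /BVnorm leeDr//.
  exact: essential_variation_ge0.
have : J (fun y => `|centered_indic t c y * f y|) <= J (fun y => `|f y|).
  apply: le_int; [exact: L1_norm|exact: L1_norm|move=> x Ix].
  by rewrite normrM ler_piMl// centered_indic_bound.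
move: J0 Jb b0; move: (J (fun y => `|f y|)) (J (fun y => `|centered_indic t c y * f y|)).
by clear => p q; lra.
Qed.

(** * Exponential moments of a coboundary plus a martingale *)

Section ExponentialMoment.

(** For [x <= 1/2] one compares [expR x <= 1 / (1 - x) <= x + 1 + 2 * x ^+ 2]; beyond,
    [x <= 2 * x ^+ 2] suffices. The linear term stays outside the exponential so that it can
    integrate to zero. *)
Lemma expR_le_quadratic (x : R) : expR x <= x + expR (2 * x ^+ 2).
Proof.
have e2 := expR_ge1Dx (2 * x ^+ 2).
have [x1|x1] := leP x (2^-1); last first.
  apply: (@le_trans _ _ (expR (2 * x ^+ 2))); last by rewrite lerDr; lra.
  by rewrite ler_expR; nra.
have d0 : 0 < 1 - x by lra.
have : expR x <= (1 - x)^-1.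
  rewrite -[x]opprK expRN lef_pV2 ?posrE ?expR_gt0//; first by rewrite opprK expR_ge1Dx.
  by rewrite opprK.
move=> /le_trans; apply.
rewrite -[leLHS]mul1r ler_pdivrMr//.
apply: (@le_trans _ _ ((x + (1 + 2 * x ^+ 2)) * (1 - x))); last first.
  by rewrite ler_wpM2r ?lerD2l// ltW.
have -> : (x + (1 + 2 * x ^+ 2)) * (1 - x) = 1 + x ^+ 2 * (1 - 2 * x) by ring.
by rewrite lerDl mulr_ge0// ?sqr_ge0//; lra.
Qed.

(** Weak form of the relation P_T f = h, independent of the representative chosen by [transfer]. *)
Definition dual_pairing T f h :=
  forall g, bdd g -> J (fun x => h x * g x) = J (fun x => f x * g (T x)).

Lemma is_transfer_pairing T f h : measurable_fun I T -> set_fun I I T ->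
  L1 f -> is_transfer T f h -> dual_pairing T f h.
Proof.
move=> mT IT Lf [Lh fh] g bg.
by congr fine; apply: fh; exact: bdd_Linfty.
Qed.

Context (T : nat -> R -> R) (phi H h : nat -> R -> R) (B : R).
Hypothesis mT : forall k, measurable_fun I (T k.+1).
Hypothesis IT : forall k, set_fun I I (T k.+1).
Hypothesis bphi : forall k, bdd (phi k).
Hypothesis phi1 : forall k x, I x -> `|phi k x| <= 1.
Hypothesis bH : forall k, bdd (H k).
Hypothesis HB : forall k x, I x -> `|H k x| <= B.
Hypothesis Lh : forall k, L1 (h k).
Hypothesis h0 : forall k, {ae mu, forall x, I x -> 0 <= h k x}.
Hypothesis h1 : forall k, J (h k) = 1.
Hypothesis Th : forall k, dual_pairing (T k.+1) (h k) (h k.+1).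
Hypothesis TH : forall k, dual_pairing (T k.+1)
  (fun x => h k x * (phi k x + H k x)) (fun x => h k.+1 x * H k.+1 x).

(** The recursion peels off the earliest term, so that the rest is a function of [T k.+1 y], as a
    reverse martingale argument demands. *)
Fixpoint birkhoff (p k : nat) (y : R) : R :=
  if p is p'.+1 then phi k y + birkhoff p' k.+1 (T k.+1 y) else 0.

Lemma bdd_birkhoff p k : bdd (birkhoff p k).
Proof.
elim: p k => [|p IH] k /=; first exact: (bdd_cst 0).
by apply: bddD => //; exact: bdd_comp (IH _).
Qed.

(** By [Th] and [TH] the increment [M] is orthogonal, with respect to the density [h k], to every
    bounded function of [T k.+1]. The linear term of [expR_le_quadratic] therefore disappears, and
    no conditional expectation has to be constructed. *)
Lemma exponential_moment_step (s : R) k g : bdd g -> (forall x, I x -> 0 <= g x) ->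
  J (fun x => h k x * (expR (s * (phi k x + H k x - H k.+1 (T k.+1 x))) * g (T k.+1 x)))
  <= expR (2 * (s * (1 + 2 * B)) ^+ 2) * J (fun x => h k.+1 x * g x).
Proof.
move=> bg g0; set c := expR _.
pose M x := phi k x + H k x - H k.+1 (T k.+1 x).
have bgT : bdd (fun x => g (T k.+1 x)) by exact: bdd_comp.
have bHT : bdd (fun x => H k.+1 (T k.+1 x)) by exact: bdd_comp.
have bphiH : bdd (fun x => phi k x + H k x) by exact: bddD.
have bM : bdd M by exact: bddB.
have Mb x : I x -> `|M x| <= 1 + 2 * B.
  move=> Ix; rewrite (le_trans (ler_normB _ _))// mulr2n mulrDl mul1r addrA lerD//.
    by rewrite (le_trans (ler_normD _ _))// lerD// ?phi1 ?HB.
  by apply: HB; exact: IT.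
have M0 : J (fun x => h k x * (M x * g (T k.+1 x))) = 0.
  have -> : J (fun x => h k x * (M x * g (T k.+1 x))) =
     J (fun x => h k x * (phi k x + H k x) * g (T k.+1 x)
               - h k x * (H k.+1 (T k.+1 x) * g (T k.+1 x))).
    by apply: eq_int => x _; rewrite /M; ring.
  rewrite intB; [|by do 2 apply: L1M => //|by apply: L1M => //; exact: bddM].
  have bHg : bdd (fun x => H k.+1 x * g x) by exact: bddM.
  rewrite -(TH k bg) -(Th k bHg).
  rewrite [X in X - _](_ : _ = J (fun x => h k.+1 x * (H k.+1 x * g x))) ?subrr//.
  by apply: eq_int => x _; rewrite mulrA.
apply: (@le_trans _ _ (J (fun x => s * (h k x * (M x * g (T k.+1 x)))
                                   + c * (h k x * g (T k.+1 x))))).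
  have L1' : L1 (fun x => h k x * (M x * g (T k.+1 x))) by apply: L1M => //; exact: bddM.
  have L2' : L1 (fun x => h k x * g (T k.+1 x)) by exact: L1M.
  apply: ae_le_int.
  - by apply: L1M => //; apply: bddM => //; apply: bdd_expR; exact: bddZ.
  - by apply: L1D; exact: L1Z.
  - apply: (ae01S _ (h0 k)) => x Ix hx.
    have -> : s * (h k x * (M x * g (T k.+1 x))) + c * (h k x * g (T k.+1 x)) =
      h k x * ((s * M x + c) * g (T k.+1 x)) by ring.
    rewrite ler_wpM2l//.
    rewrite ler_wpM2r ?g0 ?IT//; first exact: IT.
    rewrite (le_trans (expR_le_quadratic _))// lerD2l ler_expR ler_wpM2l//.
    rewrite -[leLHS]real_normK ?num_real// -[leRHS]real_normK ?num_real//.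
    rewrite lerXn2r ?nnegrE// !normrM ler_wpM2l//.
    by rewrite (le_trans (Mb _ Ix))// ler_norm.
rewrite intD; [|by apply: L1Z; apply: L1M => //; exact: bddM|by apply: L1Z; exact: L1M].
rewrite !intZ; [|by apply: L1M => //|by apply: L1M => //; exact: bddM].
by rewrite M0 mulr0 add0r (Th k bg).
Qed.

(** Keeping [H k] in the exponent makes the sum telescope: splitting off one increment leaves the
    same expression at time [k.+1], composed with [T k.+1]. The last factor pays for the final
    corrector. *)
Lemma exponential_moment (s : R) p k :
  J (fun x => h k x * expR (s * (birkhoff p k x + H k x))) <=
  expR (2 * (s * (1 + 2 * B)) ^+ 2) ^+ p * expR (`|s| * B).
Proof.
elim: p k => [|p IH] k.
  rewrite expr0 mul1r -[leRHS]mulr1 -(h1 k) -intZ//.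
  apply: ae_le_int.
  - apply: L1M => //; apply: bdd_expR; apply: bddZ; apply: bddD => //.
    exact: bdd_birkhoff.
  - exact: L1Z.
  apply: (ae01S _ (h0 k)) => x Ix hx.
  rewrite mulrC ler_wpM2r// ler_expR /= add0r.
  by rewrite (le_trans (ler_norm _))// normrM ler_wpM2l// HB.
pose g x := expR (s * (birkhoff p k.+1 x + H k.+1 x)).
have bg : bdd g by apply: bdd_expR; apply: bddZ; apply: bddD => //; exact: bdd_birkhoff.
have -> : J (fun x => h k x * expR (s * (birkhoff p.+1 k x + H k x))) =
  J (fun x => h k x * (expR (s * (phi k x + H k x - H k.+1 (T k.+1 x))) * g (T k.+1 x))).
  apply: eq_int => x _; rewrite /g -expRD; congr (_ * expR _) => /=; ring.
apply: (le_trans (exponential_moment_step s k bg _)) => [x _|]; first exact: expR_ge0.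
by rewrite [_ ^+ p.+1]exprS -mulrA ler_wpM2l ?expR_ge0.
Qed.

End ExponentialMoment.

(** * Transfer operators along the sequence and the densities P_1^n 1 *)

Lemma transferP (T : R -> R) f : measurable_fun I T -> set_fun I I T ->
  nonsingular T -> L1 f -> is_transfer T f (transfer T f).
Proof.
move=> mT IT nT Lf; rewrite /transfer; apply: xgetPex.
exact: transfer_exists.
Qed.

Lemma L1_sum (n : nat) (a : nat -> R -> R) : (forall j, L1 (a j)) ->
  L1 (fun x => \sum_(j < n) a j x).
Proof.
move=> La; elim: n => [|m IHm].
  by under eq_fun do rewrite big_ord0; exact/bdd_L1/(bdd_cst 0).
by under eq_fun do rewrite big_ord_recr /=; exact: L1D.
Qed.

Lemma dual_pairing_sum (T : R -> R) (n : nat) (a b : nat -> R -> R) :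
  measurable_fun I T -> set_fun I I T ->
  (forall j, L1 (a j)) -> (forall j, L1 (b j)) ->
  (forall j, (j < n)%N -> dual_pairing T (a j) (b j)) ->
  dual_pairing T (fun x => \sum_(j < n) a j x) (fun x => \sum_(j < n) b j x).
Proof.
move=> mT IT La Lb ab g bg.
have bgT : bdd (fun x => g (T x)) by exact: bdd_comp.
elim: n ab => [|n IH] ab.
  by under eq_Rintegral do rewrite big_ord0 mul0r;
    under [RHS]eq_Rintegral do rewrite big_ord0 mul0r.
under eq_Rintegral do rewrite big_ord_recr /= mulrDl.
under [RHS]eq_Rintegral do rewrite big_ord_recr /= mulrDl.
rewrite !intD; try by apply: L1M => //; exact: L1_sum.
by rewrite IH ?ab// => j jn; apply: ab; rewrite ltnS ltnW.
Qed.

Section Densities.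

(** Density of the push-forward of m by [seq_comp T n], as [density_seq_comp] confirms; at time 0 it
    is the constant 1. *)
Definition density (T : nat -> R -> R) (n : nat) : R -> R :=
  seq_transfer T n (cst 1).

Context (T : nat -> R -> R) (delta : R).
Hypothesis mT : forall k, measurable_fun I (T k.+1).
Hypothesis IT : forall k, set_fun I I (T k.+1).
Hypothesis delta0 : 0 < delta.
Hypothesis delta1 : delta <= 1.
Hypothesis dmin : forall n, (1 <= n)%N ->
  {ae mu, forall x, I x -> delta <= seq_transfer T n (cst 1) x}.

Local Notation h := (density T).

(* The default value of [transfer] is zero, which the lower bound excludes. *)
Lemma density_step n : is_transfer (T n.+1) (h n) (h n.+1).
Proof.
have /= := @dmin n.+1 isT.
rewrite /density /= /transfer; case: xgetP => [g -> //|_ hm].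
have : J (cst delta) <= J (cst 0).
  by apply: ae_le_int => //; exact/bdd_L1/bdd_cst.
by rewrite !int_cst leNgt delta0.
Qed.

Lemma density_L1 n : L1 (h n).
Proof.
case: n => [|n]; first exact/bdd_L1/bdd_cst.
by case: (density_step n).
Qed.

Lemma density_ge n : {ae mu, forall x, I x -> delta <= h n x}.
Proof. by case: n => [|n]; [exact: ae01W|exact: dmin]. Qed.

Lemma density_pairing n : dual_pairing (T n.+1) (h n) (h n.+1).
Proof.
by apply: is_transfer_pairing => //; [exact: density_L1|exact: density_step].
Qed.

Lemma density_mass n : J (h n) = 1.
Proof.
elim: n => [|n IH]; first by rewrite int_cst.
have := density_pairing n (bdd_cst 1).
under eq_Rintegral do rewrite mulr1; move=> ->.
by under eq_Rintegral do rewrite mulr1.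
Qed.

Lemma density_L1norm n : J (fun x => `|h n x|) = 1.
Proof.
rewrite -(density_mass n); apply: ae_eq_int.
- exact: (L1_meas (L1_norm (density_L1 n))).
- exact: (L1_meas (density_L1 n)).
- by apply: (ae01S _ (density_ge n)) => x _ hx; rewrite ger0_norm// (le_trans _ hx)// ltW.
Qed.

(** If [E] is the preimage of a null set [N], the integral of [h n] over [E] equals that of [h n.+1]
    over [N], which is zero; since [h n >= delta], [E] is null. *)
Lemma density_nonsingular n : nonsingular (T n.+1).
Proof.
move=> N mN N0.
have mE : measurable (I `&` T n.+1 @^-1` N) by exact: (mT _ mI mN).
set E := _ `&` _ in mE *.
have bE : bdd (\1_E : R -> R) by exact: bdd_indic.
have h0 : J (fun x => h n x * \1_E x) = 0.
  have -> : J (fun x => h n x * \1_E x) = J (fun x => h n x * \1_N (T n.+1 x)).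
    apply: eq_int => x Ix; rewrite !indicE; congr (_ * (nat_of_bool _)%:R).
    by apply/idP/idP; rewrite !inE; [case|split].
  rewrite -(density_pairing n (bdd_indic mN)) -[RHS](int_cst 0).
  apply: ae_eq_int; [|exact: measurable_cst|].
    exact: (L1_meas (L1M (density_L1 n.+1) (bdd_indic mN))).
  exists N; split => // x /= xN; apply: contrapT => nN; apply: xN => Ix.
  by rewrite indicE memNset// mulr0.
have J0 : J \1_E = 0.
  have : delta * J \1_E <= 0.
    rewrite -h0 -intZ; last exact: bdd_L1.
    apply: ae_le_int; [exact/L1Z/bdd_L1|by apply: L1M => //; exact: density_L1|].
    by apply: (ae01S _ (density_ge n)) => x _ hx; rewrite ler_wpM2r// indicE.
  rewrite pmulr_rle0// => J0; apply/le_anti; rewrite J0 /=.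
  by apply: Rintegral_ge0 => x _; exact: ler0n.
have := L1_EFin (bdd_L1 bE); rewrite J0 integral_indic//; last exact: mIs.
by rewrite (_ : E `&` I = E)//; apply/setIidPl => x [].
Qed.

Lemma transfer_step n f : L1 f -> is_transfer (T n.+1) f (transfer (T n.+1) f).
Proof. by move=> Lf; apply: transferP => //; exact: density_nonsingular. Qed.

Lemma transfer_L1 n f : L1 f -> L1 (transfer (T n.+1) f).
Proof. by move=> /(transfer_step n)[]. Qed.

Lemma seq_transfer_L1 k n f : L1 f -> L1 (seq_transfer (fun i => T (k + i)%N) n f).
Proof.
move=> Lf; elim: n => [//|n IH] /=.
by rewrite addnS; exact: transfer_L1.
Qed.

Lemma transfer_pairing n f : L1 f -> dual_pairing (T n.+1) f (transfer (T n.+1) f).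
Proof. by move=> Lf; apply: is_transfer_pairing => //; exact: transfer_step. Qed.

End Densities.

Lemma seq_transfer_add (T : nat -> R -> R) (k n : nat) (f : R -> R) :
  seq_transfer T (k + n) f =
  seq_transfer (fun i => T (k + i)%N) n (seq_transfer T k f).
Proof. by elim: n => [|n IH]; rewrite ?addn0// addnS /= IH addnS. Qed.

(** Lasota-Yorke argument: the densities have L^1 norm 1, so [r] steps turn a bound [D] into
    [rho * D + Cr], and strong induction advances by blocks of length [r]. *)
Lemma density_BVnorm (T : nat -> R -> R) (delta : R) (C : set (R -> R)) (r : nat) :
  (1 <= r)%N -> 0 < delta -> delta <= 1 ->
  (forall k, measurable_fun I (T k.+1)) -> (forall k, set_fun I I (T k.+1)) ->
  (forall n, (1 <= n)%N ->
    {ae mu, forall x, I x -> delta <= seq_transfer T n (cst 1) x}) ->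
  (forall n, (1 <= n)%N -> C (T n)) -> cond_D r C ->
  exists2 D : R, 0 < D & forall n, (BVnorm (density T n) < D%:E)%E.
Proof.
move=> r_gt0 d0 d1 mT IT dm CT [rho [M0 [Cr [/andP[r0 r1] M00 Cr0 PM Pr]]]].
have Lh := density_L1 d0 dm.
(* A bound depending on [k], obtained from [M0]; it serves only for the initial times [k < r]. *)
have Bk k : exists D : R, (BVnorm (density T k) <= D%:E)%E.
  elim: k => [|k [D IH]].
    exists (0 + Rintegral mu I (fun=> `|1|)).
    apply: (proj2 (@BVnorm_le (cst 1) (cst 1) 0 _ _ _)).
    - exact/bdd_L1/bdd_cst.
    - exact: ae01W.
    - have nd : {in `[(0:R), 1] &, nondecreasing_fun (cst 1 : R -> R)} by [].
      by rewrite (nondecreasing_total_variation _ nd)// lee_fin /= subrr.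
  exists (M0 * D).
  have := PM (T k.+1) (density T k) (CT k.+1 isT) (BV_BVnorm (Lh k) IH).
  rewrite /density /= => /le_trans; apply.
  by rewrite EFinM lee_pmul2l.
have [D0 D00 Dr] : exists2 D : R, 0 <= D &
    forall k, (k < r)%N -> (BVnorm (density T k) <= D%:E)%E.
  elim: (r) => [|m [D D0 IH]]; first by exists 0.
  have [D' hD'] := Bk m; exists (Num.max D D'); first by rewrite le_max D0.
  move=> k; rewrite ltnS leq_eqVlt => /predU1P[->|km].
    by apply: (le_trans hD'); rewrite lee_fin le_max lexx orbT.
  by apply: (le_trans (IH _ km)); rewrite lee_fin le_max lexx.
have r1' : 0 < 1 - rho by rewrite subr_gt0.
(* [Cr / (1 - rho)] is the fixed point of [x -> rho * x + Cr]; adding [D0] covers the first [r]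
   densities. *)
pose D := D0 + Cr / (1 - rho).
have CrD : rho * D + Cr <= D.
  have : D * (1 - rho) = D0 * (1 - rho) + Cr by rewrite mulrDl divfK// gt_eqF.
  have : 0 <= D0 * (1 - rho) by rewrite mulr_ge0// ltW.
  lra.
have hD n : (BVnorm (density T n) <= D%:E)%E.
  elim/ltn_ind: n => n IH; have [nr|rn] := ltnP n r.
    by apply: (le_trans (Dr _ nr)); rewrite lee_fin lerDl divr_ge0 ?ltW.
  have nE : density T n = seq_transfer (fun i => T (n - r + i)%N) r (density T (n - r)).
    by rewrite -seq_transfer_add subnK.
  have IHr : (BVnorm (density T (n - r)) <= D%:E)%E.
    by apply: IH; rewrite ltn_subrL r_gt0 (leq_trans r_gt0).
  have := Pr (fun i => T (n - r + i)%N) _ _ (BV_BVnorm (Lh _) IHr).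
  rewrite -nE L1normE// (density_L1norm mT IT d0 d1 dm) mule1 => /(_ _)/le_trans; apply.
    by move=> i /andP[i1 _]; apply: CT; rewrite addn_gt0 i1 orbT.
  apply: (@le_trans _ _ (rho%:E * D%:E + Cr%:E)%E).
    by rewrite leeD2r// lee_pmul2l.
  by rewrite -EFinM -EFinD lee_fin.
exists (D + 1); first by rewrite ltr_wpDl// addr_ge0// divr_ge0 ?ltW.
by move=> n; apply: (le_lt_trans (hD n)); rewrite lte_fin ltrDl.
Qed.

(** * Martingale approximation *)

Section MartingaleApproximation.

Lemma geometric_sum_le (theta : R) n : 0 < theta < 1 ->
  \sum_(j < n) theta ^+ (n - j) <= (1 - theta)^-1.
Proof.
move=> /andP[t0 t1]; have d0 : 0 < 1 - theta by lra.
elim: n => [|n IH]; first by rewrite big_ord0 invr_ge0 ltW.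
rewrite big_ord_recr /= subSnn expr1.
rewrite (eq_bigr (fun i : 'I_n => theta * theta ^+ (n - i))); last first.
  by move=> i _; rewrite subSn ?exprS// ltnW.
rewrite -mulr_sumr; set S := \sum_(i < n) _ in IH *.
have -> : theta * S + theta = theta * (S + 1) by ring.
apply: (@le_trans _ _ (theta * ((1 - theta)^-1 + 1))).
  by rewrite ler_wpM2l ?lerD2r// ltW.
rewrite -[X in _ + X](@mulfV _ (1 - theta)) ?gt_eqF//.
rewrite -[X in X + _]mul1r -mulrDl mulrA -[leRHS]mul1r ler_wpM2r ?invr_ge0 ?ltW//.
(* What remains amounts to [0 <= (1 - theta) ^+ 2]. *)
nra.
Qed.

Lemma ae_sum_le (n : nat) (a : nat -> R -> R) (e : nat -> R) :
  (forall j, (j < n)%N -> {ae mu, forall x, I x -> `|a j x| <= e j}) ->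
  {ae mu, forall x, I x -> `|\sum_(j < n) a j x| <= \sum_(j < n) e j}.
Proof.
elim: n => [|n IH] ae_; first by apply: ae01W => x _; rewrite !big_ord0 normr0.
have ae1 := ae_ n (ltnSn n).
have ae2 := IH (fun j jn => ae_ j (ltnW jn)).
apply: (ae01S2 _ ae1 ae2) => x _ h1 h2.
by rewrite !big_ord_recr /= (le_trans (ler_normD _ _))// lerD.
Qed.

Lemma dual_pairing_ae (T : R -> R) f h f' h' : measurable_fun I T -> set_fun I I T ->
  L1 f -> L1 h -> L1 f' -> L1 h' -> ae_eq01 f f' -> ae_eq01 h h' ->
  dual_pairing T f h -> dual_pairing T f' h'.
Proof.
move=> mT IT Lf Lh Lf' Lh' ff' hh' fh g bg.
have bgT : bdd (fun x => g (T x)) by exact: bdd_comp.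
transitivity (J (fun x => h x * g x)).
  apply: ae_eq_int; [exact: (L1_meas (L1M Lh' bg))|exact: (L1_meas (L1M Lh bg))|].
  by apply: (ae01S _ hh') => x _ ->.
rewrite (fh g bg).
apply: ae_eq_int; [exact: (L1_meas (L1M Lf bgT))|exact: (L1_meas (L1M Lf' bgT))|].
by apply: (ae01S _ ff') => x _ ->.
Qed.

Context (T : nat -> R -> R) (delta b theta K0 : R).
Hypothesis mT : forall k, measurable_fun I (T k.+1).
Hypothesis IT : forall k, set_fun I I (T k.+1).
Hypothesis delta0 : 0 < delta.
Hypothesis delta1 : delta <= 1.
Hypothesis dmin : forall n, (1 <= n)%N ->
  {ae mu, forall x, I x -> delta <= seq_transfer T n (cst 1) x}.
Hypothesis b0 : 0 < b.
Hypothesis hb : forall n, (BVnorm (density T n) < b%:E)%E.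
Hypothesis theta01 : 0 < theta < 1.
Hypothesis K00 : 0 < K0.
Hypothesis hdec : forall j l f, (1 <= l)%N -> BV f ->
  (\int[mu]_(x in I) (f x)%:E = 0)%E ->
  (BVnorm (seq_transfer (fun i => T (j + i)%N) l f)
    <= (K0 * theta ^+ l)%:E * BVnorm f)%E.

Local Notation h := (density T).
Let Lh := density_L1 delta0 dmin.
Let h1 := density_mass mT IT delta0 dmin.
Let hge := density_ge delta1 dmin.

Lemma seq_comp_meas j : measurable_fun I (seq_comp T j) /\ set_fun I I (seq_comp T j).
Proof.
elim: j => [|j [mj Ij]]; first by split; [exact: measurable_id|move=> x].
split; last by move=> x /Ij; exact: IT.
by apply: (measurable_comp mI) => // _ [x Ix <-]; exact: Ij.
Qed.

Lemma density_seq_comp j g : bdd g ->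
  J (fun x => h j x * g x) = J (fun x => g (seq_comp T j x)).
Proof.
elim: j g => [|j IH] g bg; first by apply: eq_int => x _; rewrite mul1r.
rewrite (density_pairing mT IT delta0 dmin)// IH//.
exact: bdd_comp.
Qed.

(** * The corrector at a fixed threshold *)

Section FixedThreshold.
Context (t : R).

Definition cdf_mean (j : nat) : R := J (fun x => (seq_comp T j x <= t)%R%:R).

Lemma cdf_meanE j : J (fun x => h j x * (x <= t)%R%:R) = cdf_mean j.
Proof. exact: (density_seq_comp j (bdd_le t)). Qed.

Lemma cdf_mean01 j : 0 <= cdf_mean j <= 1.
Proof.
have [mj Ij] := seq_comp_meas j.
apply/andP; split; first by apply: Rintegral_ge0 => x _; exact: ler0n.
rewrite -[leRHS](int_cst 1); apply: le_int.
- by apply: bdd_L1; apply: (bdd_comp mj Ij (bdd_le t)).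
- exact/bdd_L1/bdd_cst.
- by move=> x _; rewrite lern1 leq_b1.
Qed.

Let phi j := centered_indic t (cdf_mean j).
Let psi j x := phi j x * h j x.

Let psiP j : [/\ L1 (psi j), BV (psi j) & (BVnorm (psi j) <= (3 * b)%:E)%E].
Proof. exact: BVnorm_centered_indic_mul (cdf_mean01 j) (Lh j) (hb j). Qed.

Let Lpsi j : L1 (psi j). Proof. by case: (psiP j). Qed.

(** The centring by [cdf_mean j] is what allows the decay hypothesis to be applied to [psi j]. *)
Let psi_mean0 j : J (psi j) = 0.
Proof.
have -> : J (psi j) = J (fun x => h j x * (x <= t)%R%:R - cdf_mean j * h j x).
  by apply: eq_int => x _; rewrite /psi /phi /centered_indic; ring.
rewrite intB ?intZ//; last by apply: L1Z.
  by rewrite h1 mulr1 cdf_meanE subrr.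
exact: (L1M (Lh j) (bdd_le t)).
Qed.

(** This is P_(j+1)^(j+l) applied to [psi j], a function living at time [j + l]. *)
Let v j l := seq_transfer (fun i => T (j + i)%N) l (psi j).

Let Lv j l : L1 (v j l).
Proof. exact: (seq_transfer_L1 mT IT delta0 delta1 dmin). Qed.

(** The constant 3 of [BVnorm_centered_indic_mul] becomes 4 to reach the strict inequality that
    [BVnorm_ae_bound] asks for. *)
Let v_bound j l : (1 <= l)%N ->
  {ae mu, forall x, I x -> `|v j l x| <= 4 * b * K0 * theta ^+ l}.
Proof.
move=> l1; apply: BVnorm_ae_bound => //.
have [_ BVp np] := psiP j.
have psi0 : (\int[mu]_(x in I) (psi j x)%:E = 0)%E by rewrite L1_EFin// psi_mean0.
apply: (le_lt_trans (hdec j l1 BVp psi0)).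
have th : 0 < theta ^+ l by rewrite exprn_gt0//; case/andP: theta01.
apply: (@le_lt_trans _ _ ((K0 * theta ^+ l)%:E * (3 * b)%:E)%E).
  by rewrite lee_pmul2l// lte_fin mulr_gt0.
rewrite -EFinM lte_fin.
have : 0 < K0 * theta ^+ l * b by rewrite !mulr_gt0.
by move: (theta ^+ l) => q; nra.
Qed.

(** Only times [j < n] enter, so each term has undergone at least one transfer and the decay
    estimate covers it. *)
Let Q n x := \sum_(j < n) v j (n - j) x.

Let LQ n : L1 (Q n).
Proof. by apply: (@L1_sum n (fun j => v j (n - j))) => j; exact: Lv. Qed.

Let B0 := 4 * b * K0 * (1 - theta)^-1.

Let Q_bound n : {ae mu, forall x, I x -> `|Q n x| <= B0}.
Proof.
have := @ae_sum_le n (fun j => v j (n - j)) (fun j => 4 * b * K0 * theta ^+ (n - j)).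
have nj j : (j < n)%N -> (1 <= n - j)%N by rewrite subn_gt0.
move=> /(_ (fun j jn => v_bound j (nj j jn))); apply: ae01S => x _ /le_trans; apply.
rewrite -mulr_sumr ler_wpM2l ?geometric_sum_le//.
by rewrite !mulr_ge0// ltW.
Qed.

(** [psi n] is the missing term [v n 0]; one more transfer raises every second index by one. *)
Let Q_step n : dual_pairing (T n.+1) (fun x => Q n x + psi n x) (Q n.+1).
Proof.
have -> : (fun x => Q n x + psi n x) = (fun x => \sum_(j < n.+1) v j (n - j) x).
  by apply/funext => x; rewrite big_ord_recr /= subnn.
apply: (@dual_pairing_sum (T n.+1) n.+1 (fun j => v j (n - j))
  (fun j => v j (n.+1 - j))) => //.
move=> j jn; have jn' : (j <= n)%N by rewrite -ltnS.
rewrite subSn// /v /= addnS subnKC//.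
apply: (transfer_pairing mT IT delta0 delta1 dmin).
exact: Lv.
Qed.

Let B := B0 / delta.

Let B_ge0 : 0 <= B.
Proof.
have [t0 t1] := andP theta01.
by rewrite /B /B0 divr_ge0 ?mulr_ge0 ?invr_ge0 ?subr_ge0// ltW.
Qed.

(* A truncation of [Q n / h n]; writing the inverse as [expR (- ln _)] makes it
   measurable. *)
Let H n x := Num.max (- B) (Num.min (Q n x * expR (- ln (Num.max (h n x) delta))) B).

Let HB n x : I x -> `|H n x| <= B.
Proof.
move=> _; rewrite /H ler_norml le_max lexx /=.
by rewrite ge_max ge_min lexx orbT andbT -subr_ge0 opprK addr_ge0.
Qed.

Let bH n : bdd (H n).
Proof.
split.
  apply: measurable_maxr => //; apply: measurable_minr => //.
  apply: measurable_funM; first exact: L1_meas.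
  apply: (measurableT_comp (@measurable_expR R)).
  apply: measurable_funN; apply: (measurableT_comp (@measurable_ln R)).
  by apply: measurable_maxr => //; exact: L1_meas.
by exists B => x; exact: HB.
Qed.

(** Almost everywhere [|Q n| <= B0] and [h n >= delta], so the quotient is at most [B] in absolute
    value and neither the truncation nor the maximum acts. *)
Let hH n : {ae mu, forall x, I x -> h n x * H n x = Q n x}.
Proof.
apply: (ae01S2 _ (hge n) (Q_bound n)) => x _ hx Qx.
have hp : 0 < h n x by exact: lt_le_trans hx.
have QB : `|Q n x / h n x| <= B.
  rewrite normrM normfV [`|h n x|]gtr0_norm// /B.
  by apply: ler_pM => //; rewrite ?lef_pV2 ?posrE// invr_ge0 ltW.
have mh : Num.max (h n x) delta = h n x by rewrite max_l.
rewrite /H mh expRN lnK ?posrE//.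
move: QB; rewrite ler_norml => /andP[QB1 QB2].
by rewrite min_l// max_r// mulrC divfK// gt_eqF.
Qed.

Let H_step n : dual_pairing (T n.+1) (fun x => h n x * (phi n x + H n x))
  (fun x => h n.+1 x * H n.+1 x).
Proof.
have bphi : bdd (phi n) by exact: bdd_centered_indic.
apply: (dual_pairing_ae (mT n) (IT n) _ (LQ n.+1) _ _ _ _ (@Q_step n)).
- exact: L1D.
- by apply: L1M => //; exact: bddD.
- exact: L1M.
- by apply: (ae01S _ (hH n)) => x _ <-; rewrite /psi; ring.
- by apply: (ae01S _ (hH n.+1)) => x _ <-.
Qed.

(** [Q 0] is an empty sum, so the moment bound started at time 0 concerns the plain sum. *)
Let H0 x : H 0 x = 0.
Proof. by rewrite /H /Q big_ord0 mul0r min_l// max_r// oppr_le0. Qed.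

Lemma birkhoffE p k x : birkhoff T phi p k (seq_comp T k x) =
  \sum_(j < p) phi (k + j) (seq_comp T (k + j) x).
Proof.
elim: p k => [|p IH] k /=; first by rewrite big_ord0.
rewrite big_ord_recl /= addn0; congr (_ + _).
rewrite -[T k.+1 _]/(seq_comp T k.+1 x) IH; apply: eq_bigr => i _.
by rewrite /bump /= addnA addn1.
Qed.

(** The exponential moment bound is started at time 0, where the density is 1 and the corrector
    vanishes. The constant [B] depends neither on [t] nor on [n]. *)
Lemma sub_gaussian_threshold (s : R) (n : nat) :
  J (fun x => expR (s * \sum_(j < n) centered_indic t (cdf_mean j) (seq_comp T j x))) <=
  expR (2 * (s * (1 + 2 * B)) ^+ 2) ^+ n * expR (`|s| * B).
Proof.
have h_ge0 k : {ae mu, forall x, I x -> 0 <= h k x}.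
  by apply: (ae01S _ (hge k)) => x _; apply: le_trans; exact: ltW.
have bphi k : bdd (phi k) by exact: bdd_centered_indic.
have phi1 k x : I x -> `|phi k x| <= 1.
  by move=> _; apply: centered_indic_bound; exact: cdf_mean01.
have := exponential_moment mT IT bphi phi1 bH HB Lh h_ge0 h1
  (density_pairing mT IT delta0 dmin) H_step s n 0.
apply: le_trans; rewrite le_eqVlt; apply/orP; left; apply/eqP; apply: eq_int => x _.
by rewrite mul1r H0 addr0 -[in RHS](_ : seq_comp T 0 x = x)// birkhoffE.
Qed.

End FixedThreshold.
End MartingaleApproximation.

(** * From thresholds to the Kantorovich distance *)

Section Concentration.

Lemma fubini_tonelli01 (G : M * M -> R) : measurable_fun setT G ->
  (forall z, 0 <= G z) ->
  measurable_fun (I : set M) (fun x : M => \int[mu]_(t in I) (G (x, t))%:E)%E /\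
  (\int[mu]_(x in I) \int[mu]_(t in I) (G (x, t))%:E =
   \int[mu]_(t in I) \int[mu]_(x in I) (G (x, t))%:E)%E.
Proof.
move=> mG G0.
(* Multiplying by the indicator of the unit square reduces the claim to Tonelli's theorem on the
   whole plane. *)
pose f (z : M * M) : \bar R := (G z * (\1_I z.1 * \1_I z.2))%:E.
have mI1 : measurable_fun [set: M] (\1_I : M -> R).
  exact: (@measurable_indic _ M R setT I mI).
have mf : measurable_fun [set: M * M] f.
  apply/measurable_EFinP; apply: measurable_funM => //; apply: measurable_funM.
    exact: measurableT_comp mI1 measurable_fst.
  exact: measurableT_comp mI1 measurable_snd.
have f0 z : (0 <= f z)%E by rewrite lee_fin !mulr_ge0 ?ler0n.
have F1 (x : M) : (\int[mu]_t f (x, t) =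
    ((fun x => \int[mu]_(t in I) (G (x, t))%:E) \_ I) x)%E.
  rewrite patchE; case: ifPn => xI.
    rewrite [RHS]integral_mkcond; apply: eq_integral => t _.
    by rewrite /f patchE /= !indicE xI mul1r; case: ifPn; rewrite ?mulr1 ?mulr0.
  rewrite -[RHS](integral0 mu setT); apply: eq_integral => t _.
  by rewrite /f /= !indicE (negbTE xI) mul0r mulr0.
have F2 (t : M) : (\int[mu]_x f (x, t) =
    ((fun t => \int[mu]_(x in I) (G (x, t))%:E) \_ I) t)%E.
  rewrite patchE; case: ifPn => tI.
    rewrite [RHS]integral_mkcond; apply: eq_integral => x _.
    by rewrite /f patchE /= !indicE tI mulr1; case: ifPn; rewrite ?mulr1 ?mulr0.
  rewrite -[RHS](integral0 mu setT); apply: eq_integral => x _.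
  by rewrite /f /= !indicE (negbTE tI) !mulr0.
split.
  apply/(measurable_restrictT _ mIs).
  have := measurable_fun_fubini_tonelli_F (m2 := mu) f mf f0.
  suff -> : fubini_F mu f = (fun x => \int[mu]_(t in I) (G (x, t))%:E)%E \_ I by [].
  by apply/funext => x; exact: F1.
rewrite [LHS]integral_mkcond [RHS]integral_mkcond.
under eq_integral do rewrite -F1.
under [RHS]eq_integral do rewrite -F2.
exact: fubini_tonelli.
Qed.

Context (T : nat -> R -> R).
Hypothesis mT : forall k, measurable_fun I (T k.+1).
Hypothesis IT : forall k, set_fun I I (T k.+1).

(** For [x] and [t] in [0,1] this is [n] times the difference at [t] of the distribution functions
    of the empirical measure and of its mean. *)
Definition fluctuation (n : nat) (x t : R) : R :=
  \sum_(j < n) centered_indic t (cdf_mean T t j) (seq_comp T j x).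

Lemma fluctuation_bound n x t : `|fluctuation n x t| <= n%:R.
Proof.
rewrite /fluctuation (le_trans (ler_norm_sum _ _ _))//.
rewrite -[X in _ <= X%:R](card_ord n) -sumr_const; apply: ler_sum => j _.
by apply: centered_indic_bound; exact: cdf_mean01.
Qed.

Lemma cdf_mean_measurable j : measurable_fun [set: M] (fun t : M => cdf_mean T t j).
Proof.
apply: nondecreasing_measurable => // s t st.
have [mj Ij] := seq_comp_meas mT IT j.
apply: le_int.
- by apply: bdd_L1; apply: (bdd_comp mj Ij (bdd_le s)).
- by apply: bdd_L1; apply: (bdd_comp mj Ij (bdd_le t)).
- move=> x _; rewrite ler_nat.
  by have [xs|//] := boolP (seq_comp T j x <= s); rewrite (le_trans xs st).
Qed.

(* Joint measurability requires a version that is also controlled off [0,1]. *)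
Lemma fluctuation_measurable n : exists F : M * M -> R,
  measurable_fun setT F /\ forall x t, I x -> F (x, t) = fluctuation n x t.
Proof.
pose U j : M -> M := seq_comp T j \_ I.
pose F (z : M * M) : R := \sum_(j < n) ((U j z.1 <= z.2)%R%:R - cdf_mean T z.2 j).
exists F; split; last first.
  by move=> x t Ix; apply: eq_bigr => j _; rewrite /U patchE mem_set.
apply: (measurable_sum _ (h := fun (j : 'I_n) (z : M * M) =>
  ((U j z.1 <= z.2)%R%:R - cdf_mean T z.2 j))) => j.
have [mj Ij] := seq_comp_meas mT IT j.
have mU : measurable_fun [set: M] (U j : M -> M).
  exact: (iffLR (measurable_restrictT _ mI) mj).
have m1 : measurable_fun [set: M * M] (fun z : M * M => U j z.1 : R).
  exact: (measurableT_comp mU measurable_fst).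
have m2 : measurable_fun [set: M * M] (fun z : M * M => z.2 : R).
  exact: measurable_snd.
apply: measurable_funB; last first.
  exact: (measurableT_comp (cdf_mean_measurable j) measurable_snd).
have := @measurable_fun_ifT _ _ _ _ (cst (1 : R)) (cst (0 : R)) _
  (measurable_fun_ler m1 m2) (measurable_cst _) (measurable_cst _).
by apply: eq_measurable_fun => z _ /=; case: (_ <= _).
Qed.

Lemma fluctuation_bdd n x : I x -> bdd (fluctuation n x).
Proof.
move=> Ix; have [F [mF FE]] := fluctuation_measurable n.
split.
  apply: (@eq_measurable_fun _ _ _ _ _ (fun t : M => F (x, t))).
    by move=> t _; rewrite FE.
  apply: measurable_funTS; exact: (measurableT_comp mF (pair1_measurable x)).
by exists n%:R => t _; exact: fluctuation_bound.
Qed.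

Lemma fluctuation_bddl n t : bdd (fun x => fluctuation n x t).
Proof.
split; last first.
  by exists n%:R => x _; exact: fluctuation_bound.
apply: measurable_sum => j; have [mj Ij] := seq_comp_meas mT IT j.
exact: bdd_meas (bdd_comp mj Ij (bdd_centered_indic t (cdf_mean T t j))).
Qed.

Lemma bdd_norm (f : R -> R) : bdd f -> bdd (fun x => `|f x|).
Proof.
move=> [mf [k hk]]; split; last by exists k => x /hk; rewrite normr_id.
exact: measurableT_comp (@normr_measurable R setT) mf.
Qed.

Lemma kantorovichE n x : I x ->
  kantorovich (empirical_measure T n x) (mean_measure T n) =
  (\int[mu]_(t in I) (n%:R^-1 * `|fluctuation n x t|)%:E)%E.
Proof.
move=> Ix; apply: eq_integral => t; rewrite inE => It.
have in0t j y : I y -> (seq_comp T j y \in `[0, t]%classic) = (seq_comp T j y <= t).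
  move=> Iy; have [_ Ij] := seq_comp_meas mT IT j.
  have /I01E/andP[y0 _] := Ij _ Iy.
  by apply/idP/idP; rewrite inE /= in_itv /= y0.
rewrite /empirical_measure /mean_measure.
under eq_bigr do rewrite diracE in0t//.
have pE (k : 'I_n) : pushforward unit_lebesgue (seq_comp T k) `[0, t]%classic =
    (cdf_mean T t k)%:E.
  have [mj Ij] := seq_comp_meas mT IT k.
  have mE : measurable (I `&` seq_comp T k @^-1` `[0, t]).
    by apply: (mj mI); exact: measurable_itv.
  rewrite /cdf_mean.
  have -> : J (fun y => (seq_comp T k y <= t)%R%:R) =
      J \1_(I `&` seq_comp T k @^-1` `[0, t]).
    apply: eq_int => y Iy; rewrite indicE -in0t//; congr (nat_of_bool _)%:R.
    by apply/idP/idP; rewrite !inE; [split|case].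
  rewrite -L1_EFin; last exact/bdd_L1/bdd_indic.
  rewrite integral_indic//; last exact: mIs.
  rewrite /pushforward /unit_lebesgue /mrestr; congr (mu _).
  by rewrite [RHS]setIC setIA setIid setIC.
under [X in (_ - _ * X)%E]eq_bigr do rewrite pE.
rewrite !sumEFin -!EFinM -EFinB abse_EFin -mulrBr normrM ger0_norm ?invr_ge0//.
by rewrite -sumrB.
Qed.

(** Chernoff bound: on the event the average over [t] of the exponentials is at least [expR c], and
    exchanging the integrals bounds the mean of that average by [K], which is uniform in [t]. *)
Lemma kantorovich_tail (n : nat) (s v K : R) : (1 <= n)%N -> 0 < s ->
  (forall t, I t -> J (fun x => expR (s * `|fluctuation n x t|)) <= K) ->
  (unit_lebesgue [set x | I x /\
     (v%:E < kantorovich (empirical_measure T n x) (mean_measure T n))%E]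
   <= (K * expR (- (s * n%:R * v)))%:E)%E.
Proof.
move=> n1 s0 hK; set X := [set x | _].
have n0 : 0 < n%:R :> R by rewrite ltr0n.
have [F [mF FE]] := fluctuation_measurable n.
pose c := s * n%:R * v.
have cq_le q : v < n%:R^-1 * q -> c <= s * q.
  rewrite (ltr_pdivlMl _ _ n0) => /ltW vq.
  by rewrite /c -mulrA; apply: ler_wpM2l => //; exact: ltW.
pose G (z : M * M) := expR (s * `|F z|).
have mnF : measurable_fun [set: M * M] (fun z => `|F z|).
  exact: measurableT_comp (@normr_measurable R setT) mF.
have mG : measurable_fun setT G.
  apply: (measurableT_comp (@measurable_expR R)); exact: measurable_funM.
have [mIG fub] := fubini_tonelli01 mG (fun z => expR_ge0 _).
have mX : @measurable _ M X.
  have mk := proj1 (@fubini_tonelli01 (fun z => n%:R^-1 * `|F z|) _ _).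
  have -> : X = I `&` [set x | (v%:E < \int[mu]_(t in I) (n%:R^-1 * `|F (x, t)|)%:E)%E].
    have kE x : I x -> kantorovich (empirical_measure T n x) (mean_measure T n) =
        (\int[mu]_(t in I) (n%:R^-1 * `|F (x, t)|)%:E)%E.
      move=> Ix; rewrite (kantorovichE n Ix).
      by apply: eq_integral => t _; rewrite (FE _ _ Ix).
    apply/seteqP; split => x /= [Ix xv].
      by split; [|rewrite -(kE x Ix)].
    by split; [|rewrite (kE x Ix)].
  apply: emeasurable_fun_o_infty; first exact: mIs.
  apply: mk; first exact: measurable_funM.
  by move=> z; rewrite mulr_ge0// invr_ge0 ltW.
have XI : X `<=` I by move=> x [].
have Xle x : X x -> ((expR c)%:E <= \int[mu]_(t in I) (G (x, t))%:E)%E.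
  move=> [Ix]; rewrite (kantorovichE n Ix).
  have bf := fluctuation_bdd n Ix.
  have bnf := bdd_norm bf.
  rewrite (L1_EFin (bdd_L1 (bddZ n%:R^-1 bnf))).
  rewrite lte_fin intZ; last exact: bdd_L1.
  move=> /cq_le cq.
  have -> : (\int[mu]_(t in I) (G (x, t))%:E =
      (J (fun t => expR (s * `|fluctuation n x t|)))%:E)%E.
    rewrite -(L1_EFin (bdd_L1 (bdd_expR (bddZ s bnf)))).
    by apply: eq_integral => t _; rewrite /G (FE _ _ Ix).
  rewrite lee_fin.
  (* The tangent inequality [e^a >= e^c (1 + a - c)] plays the part of Jensen. *)
  apply: (@le_trans _ _ (J (fun t => expR c * (1 - c)
                                     + (expR c * s) * `|fluctuation n x t|))).
    rewrite intD; [|exact/bdd_L1/bdd_cst|exact: (L1Z _ (bdd_L1 bnf))].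
    rewrite int_cst intZ; last exact: bdd_L1.
    move: cq; move: (J (fun t => `|fluctuation n x t|)) => q cq.
    have -> : expR c * (1 - c) + expR c * s * q = expR c * (1 + (s * q - c)) by ring.
    by apply: ler_peMr; [exact: expR_ge0|rewrite lerDl subr_ge0; exact: cq].
  apply: le_int.
  - by apply: L1D; [exact/bdd_L1/bdd_cst|exact: (L1Z _ (bdd_L1 bnf))].
  - exact: (bdd_L1 (bdd_expR (bddZ _ bnf))).
  move=> t _; move: (`|fluctuation n x t|) => q.
  have -> : expR c * (1 - c) + expR c * s * q = expR c * (1 + (s * q - c)) by ring.
  rewrite -[in leRHS](subrK c (s * q)) [in leRHS]addrC expRD.
  by apply: ler_wpM2l; [exact: expR_ge0|exact: expR_ge1Dx].
have XE : unit_lebesgue X = mu X.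
  by rewrite /unit_lebesgue /mrestr; congr (mu _); exact/setIidPl.
rewrite XE expRN EFinM (lee_pdivlMr _ _ (expR_gt0 _)) muleC.
rewrite -(integral_cst mu mX).
apply: (@le_trans _ _ (\int[mu]_(x in X) \int[mu]_(t in I) (G (x, t))%:E)%E).
  apply: ge0_le_integral; first exact: mX.
  - by move=> x _; rewrite lee_fin; exact: expR_ge0.
  - exact: measurable_cst.
  - exact: measurable_funS mIs XI mIG.
  - exact: Xle.
apply: (@le_trans _ _ (\int[mu]_(x in I) \int[mu]_(t in I) (G (x, t))%:E)%E).
  apply: ge0_subset_integral; [exact: mX|exact: mIs|exact: mIG| |exact: XI].
  by move=> x _; apply: integral_ge0 => t _; rewrite lee_fin; exact: expR_ge0.
(* Exchanging the coordinates gives measurability in [t] of the integral over [x]. *)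
have mG' : measurable_fun [set: M * M] (fun z => G (z.2, z.1)).
  exact: (measurableT_comp mG (@measurable_swap _ _ M M)).
have [mIG' _] := fubini_tonelli01 mG' (fun z => expR_ge0 _).
rewrite fub; apply: (@le_trans _ _ (\int[mu]_(t in I) (cst K%:E) t)%E).
  apply: ge0_le_integral; first exact: mIs.
  - by move=> t _; apply: integral_ge0 => x _; rewrite lee_fin; exact: expR_ge0.
  - exact: mIG'.
  - exact: measurable_cst.
  move=> t It.
  have bE : bdd (fun x => expR (s * `|fluctuation n x t|)).
    exact: (bdd_expR (bddZ s (bdd_norm (fluctuation_bddl n t)))).
  have -> : (\int[mu]_(x in I) (G (x, t))%:E =
      (J (fun x => expR (s * `|fluctuation n x t|)))%:E)%E.
    rewrite -(L1_EFin (bdd_L1 bE)).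
    by apply: eq_integral => x; rewrite inE => Ix; rewrite /G (FE _ _ Ix).
  by rewrite lee_fin; exact: hK.
rewrite (integral_cst mu mIs) -[leRHS]mule1 le_eqVlt; apply/orP; left; apply/eqP.
exact: (congr1 (fun y => K%:E * y)%E (lebesgue_I01)).
Qed.

End Concentration.

End Expanding.

(* The choice of [s] minimises [2 n s^2 (1 + 2 B)^2 - s sqrt(n) t]. *)
Lemma concentration_exponent (R : realType) (B t : R) (n : nat) :
  0 <= B -> 8 * (1 + 2 * B) < t -> (1 <= n)%N ->
  let s := t / (4 * (1 + 2 * B) ^+ 2) / Num.sqrt n%:R in
  0 < s /\
  2 * (expR (2 * (s * (1 + 2 * B)) ^+ 2) ^+ n * expR (`|s| * B)) *
    expR (- (s * n%:R * (t / Num.sqrt n%:R)))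
  <= expR (- ((16 * (1 + 2 * B) ^+ 2)^-1) * t ^+ 2).
Proof.
move=> B0 tB n1 s.
set beta := 1 + 2 * B in tB s *.
have b1 : 1 <= beta by rewrite lerDl mulr_ge0.
have b0 : 0 < beta by exact: lt_le_trans b1.
(* In the variable [w] all exponents become polynomials free of [beta] and [n]. *)
have [w [tw w8]] : exists w, t = w * beta /\ 8 < w.
  by exists (t / beta); rewrite divfK ?gt_eqF// ltr_pdivlMr.
have w0 : 0 < w by exact: lt_trans w8.
have n0 : 0 < n%:R :> R by rewrite ltr0n.
pose q := Num.sqrt n%:R : R.
have q0 : 0 < q by rewrite sqrtr_gt0.
have qq : q ^+ 2 = n%:R by rewrite sqr_sqrtr// ltW.
have q1 : 1 <= q by rewrite -(sqrtr1 R) ler_wsqrtr// ler1n.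
have sE : s = w / (4 * beta * q).
  rewrite /s tw -/q; field.
  by rewrite !gt_eqF.
have s0 : 0 < s by rewrite sE divr_gt0// !mulr_gt0.
split => //.
(* The prefactor 2 is absorbed as an additive 1 in the exponent. *)
have e2 : 2 <= expR 1 :> R by rewrite (le_trans _ (expR_ge1Dx _)).
rewrite -expRM_natl.
apply: (@le_trans _ _ (expR 1 * (expR (n%:R * (2 * (s * beta) ^+ 2)) * expR (`|s| * B)) *
    expR (- (s * n%:R * (t / q))))).
  by rewrite ler_wpM2r ?expR_ge0// ler_wpM2r// mulr_ge0 ?expR_ge0.
rewrite -!expRD ler_expR gtr0_norm//.
have -> : n%:R * (2 * (s * beta) ^+ 2) = w ^+ 2 / 8.
  rewrite -qq sE; field.
  by rewrite !gt_eqF.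
have -> : s * n%:R * (t / q) = w ^+ 2 / 4.
  rewrite -qq sE tw; field.
  by rewrite !gt_eqF.
have -> : - (16 * beta ^+ 2)^-1 * t ^+ 2 = - (w ^+ 2 / 16).
  rewrite tw; field.
  by rewrite gt_eqF.
have sB : s * B <= w / 8.
  rewrite sE.
  have -> : w / (4 * beta * q) * B = (w / 8) * ((2 * B) / (beta * q)).
    field.
    by rewrite !gt_eqF.
  rewrite ler_piMr//; first by rewrite divr_ge0// ltW.
  rewrite ler_pdivrMr ?mulr_gt0// mul1r (@le_trans _ _ beta)//.
    by rewrite /beta lerDr.
  by rewrite ler_peMr// ltW.
(* It remains that [1 + w^2/8 + w/8 - w^2/4 <= - w^2/16], which holds since [w > 8]. *)
nra.
Qed.

(** * Assembly of the constants and conclusion *)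

Theorem proposition10 (R : realType)
    (C : set (R -> R)) (A : (R -> R) -> set (set R))
    (hC : forall T, C T -> piecewise_expanding T (A T))
    (hD : exists r, (1 <= r)%N /\ cond_D r C)
    (hDec : cond_Dec C)
    (hbounds : exists lambda M : R,
      [/\ 1 < lambda, 1 <= M &
        forall T, C T ->
          (lambda%:E <=
             ereal_inf [set (`|derive1 T x|)%:E | x in regular_points (A T)])%E /\
          (ereal_sup [set (`|derive1n 2 T x|)%:E | x in regular_points (A T)]
             <= M%:E)%E])
    (hcard : exists N, (1 <= N)%N /\ forall T, C T -> (A T #<= `I_N)%card)
    (T : nat -> R -> R)
    (hT : forall n, (1 <= n)%N -> C (T n))
    (hMin : cond_Min T) :
  exists t0 c : R,
    [/\ 0 < t0, 0 < c &
      forall (t : R) (n : nat), t0 < t -> (1 <= n)%N ->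
        (unit_lebesgue
           [set x | I01 x /\
              (t / Num.sqrt n%:R)%:E
                < kantorovich (empirical_measure T n x) (mean_measure T n)]
         <= (expR (- c * t ^+ 2))%:E)%E].
Proof.
have [r [r1 cD]] := hD; have [theta [K0 [theta01 K00 dec]]] := hDec.
have [delta' [delta'0 dm]] := hMin.
have CT k : C (T k.+1) by exact: hT.
have mT k := piecewise_expanding_measurable (hC _ (CT k)).
have IT k : set_fun (@I01 R) I01 (T k.+1) by case: (hC _ (CT k)).
(* The minimum with 1 extends the lower bound to time 0, where the density is the constant 1. *)
pose delta := Num.min delta' 1.
have delta0 : 0 < delta by rewrite lt_min delta'0 ltr01.
have delta1 : delta <= 1 by rewrite ge_min lexx orbT.
have dmin n : (1 <= n)%N -> {ae (@lebesgue_measure R),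
    forall x, I01 x -> delta <= seq_transfer T n (cst 1) x}.
  by move=> /dm; apply: ae01S => x _; apply: le_trans; rewrite ge_min lexx.
have [b b0 hb] := density_BVnorm r1 delta0 delta1 mT IT dmin hT cD.
have hdec (j l : nat) (f : R -> R) : (1 <= l)%N -> BV f ->
    (\int[@lebesgue_measure R]_(x in I01) (f x)%:E = 0)%E ->
    (BVnorm (seq_transfer (fun i => T (j + i)%N) l f)
      <= (K0 * theta ^+ l)%:E * BVnorm f)%E.
  move=> l1 BVf f0; apply: dec => // i /andP[i1 _]; apply: hT.
  by rewrite addn_gt0 i1 orbT.
have subg := sub_gaussian_threshold mT IT delta0 delta1 dmin b0 hb theta01 K00 hdec.
set B := 4 * b * K0 / (1 - theta) / delta in subg.
have B0 : 0 <= B.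
  have [t0 t1] := andP theta01.
  by rewrite /B !divr_ge0 ?mulr_ge0 ?subr_ge0// ltW.
have b1 : 0 < 1 + 2 * B by rewrite ltr_pwDl// mulr_ge0.
exists (8 * (1 + 2 * B)), ((16 * (1 + 2 * B) ^+ 2)^-1); split.
- by rewrite mulr_gt0.
- by rewrite invr_gt0 mulr_gt0// exprn_gt0.
move=> t n tB n1.
have [s0 sexp] := concentration_exponent R B t n B0 tB n1.
move: sexp; rewrite -lee_fin; apply: le_trans.
apply: kantorovich_tail => // u _; set s := _ / _ / _.
have bf := fluctuation_bddl mT IT n u.
have Lp : L1 (fun x => expR (s * fluctuation T n x u)).
  exact: (bdd_L1 (bdd_expR (bddZ s bf))).
have Lm : L1 (fun x => expR (- s * fluctuation T n x u)).
  exact: (bdd_L1 (bdd_expR (bddZ (- s) bf))).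
(* The absolute value is removed by [expR (s * |q|) <= expR (s * q) + expR (- s * q)]; the two signs
   account for the factor 2 in [concentration_exponent]. *)
apply: (@le_trans _ _ (Rintegral (@lebesgue_measure R) I01
  (fun x => expR (s * fluctuation T n x u) + expR (- s * fluctuation T n x u)))).
  apply: le_int; [exact: (bdd_L1 (bdd_expR (bddZ s (bdd_norm bf))))|exact: L1D|].
  move=> x _; move: (fluctuation T n x u) => q.
  have [q0|q0] := leP 0 q; first by rewrite ger0_norm// lerDl expR_ge0.
  by rewrite ltr0_norm// mulrN -mulNr lerDr expR_ge0.
rewrite intD// mulr_natl mulr2n lerD//; first exact: subg.
by have := subg u (- s) n; rewrite mulNr sqrrN normrN.
Qed.
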